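(* Let $G$ be a finite, simple, connected graph of order $n(G)$ with minimum degree at least $2$ such that $G$ is not isomorphic to the cycle $C_5$. Then $\gamma_{r2}(G)+\gamma_R(G)\leq \frac{4}{3}n(G)$.
   Context: A $2$-rainbow dominating function of a graph $G$ is a function $f:V(G)\to 2^{\{1,2\}}$ such that $\bigcup_{v\in N_G(u)}f(v)=\{1,2\}$ for every vertex $u$ with $f(u)=\emptyset$; its weight is $\sum_{u\in V(G)}|f(u)|$, and $\gamma_{r2}(G)$ is the minimum weight of such a function. A Roman dominating function of $G$ is a function $g:V(G)\to\{0,1,2\}$ such that every vertex $u$ with $g(u)=0$ has a neighbor $v$ with $g(v)=2$; its weight is $\sum_{u\in V(G)}g(u)$, and $\gamma_R(G)$ is the minimum weight of such a function. *)

(* Defs.v *)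
(* A finite simple graph is a symmetric irreflexive relation [e : rel T] on its
   finite type [T] of vertices. *)
From mathcomp Require Import all_boot all_order all_algebra.

Set Implicit Arguments.
Unset Strict Implicit.
Unset Printing Implicit Defensive.

Section Graphs.

Variables (T : finType) (e : rel T).

Definition neighborhood (u : T) : {set T} := [set v | e u v].

Definition degree (u : T) : nat := #|neighborhood u|.

Definition min_degree_ge (d : nat) : Prop := forall u : T, d <= degree u.

(* The null graph is not regarded as connected. *)
Definition connected_graph : Prop :=
  0 < #|T| /\ forall u v : T, connect e u v.

(* The colours 1 and 2 are the two elements of ['I_2]. *)
Definition rainbow2_dominating (f : {ffun T -> {set 'I_2}}) : bool :=
  [forall u, (f u == set0) ==>
    (\bigcup_(v in neighborhood u) f v == [set: 'I_2])].

Definition rainbow2_weight (f : {ffun T -> {set 'I_2}}) : nat :=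
  \sum_u #|f u|.

Definition roman_dominating (g : {ffun T -> 'I_3}) : bool :=
  [forall u, (g u == 0 :> nat) ==>
    [exists v in neighborhood u, g v == 2 :> nat]].

Definition roman_weight (g : {ffun T -> 'I_3}) : nat := \sum_u g u.

(* [arg min] needs a default value satisfying the constraint; constant
   functions provide one, and [gamma_r2P] and [gamma_RP] below show that the
   result is the actual minimum. *)
Definition gamma_r2 : nat :=
  rainbow2_weight
    [arg min_(f < [ffun=> [set: 'I_2]] | rainbow2_dominating f)
       rainbow2_weight f].

Definition gamma_R : nat :=
  roman_weight
    [arg min_(g < [ffun=> ord_max] | roman_dominating g) roman_weight g].

Lemma rainbow2_dominatingT : rainbow2_dominating [ffun=> [set: 'I_2]].
Proof.
apply/forallP => u; apply/implyP; rewrite ffunE => /eqP/setP/(_ ord0).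
by rewrite !inE.
Qed.

Lemma roman_dominating_max : roman_dominating [ffun=> ord_max].
Proof. by apply/forallP => u; rewrite ffunE. Qed.

Lemma gamma_r2P :
  (exists2 f, rainbow2_dominating f & rainbow2_weight f = gamma_r2) /\
  (forall f, rainbow2_dominating f -> gamma_r2 <= rainbow2_weight f).
Proof.
rewrite /gamma_r2; case: arg_minnP; first exact: rainbow2_dominatingT.
by move=> f domf minf; split=> //; exists f.
Qed.

Lemma gamma_RP :
  (exists2 g, roman_dominating g & roman_weight g = gamma_R) /\
  (forall g, roman_dominating g -> gamma_R <= roman_weight g).
Proof.
rewrite /gamma_R; case: arg_minnP; first exact: roman_dominating_max.
by move=> g domg ming; split=> //; exists g.
Qed.

End Graphs.

Definition graph_isomorphic (T U : finType) (e : rel T) (e' : rel U) : Prop :=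
  exists2 h : T -> U, bijective h & forall x y : T, e' (h x) (h y) = e x y.

(* The cycle [C_n], a simple graph when [2 < n]; [ordS] is the successor
   modulo [n]. *)
Definition cycle_graph (n : nat) : rel 'I_n :=
  fun i j => (j == ordS i) || (i == ordS j).

(* Main.v *)
(* Work with a vertex set [A] and a relation [e], and induct on the number of
   vertices, then on the number of edges. In a minimal counterexample an edge
   between two branch vertices (degree at least 3) can be deleted unless this
   creates a [C_5] component, and three consecutive vertices of degree 2 can be
   bypassed by an edge, at a cost of 2 + 2 = 4/3 * 3, unless they lie in a short
   cycle. So all branch vertices are pairwise nonadjacent, up to pendant [C_5]s
   joined by a bridge to a branch vertex, which are recorded as tokens on that
   vertex, and the other vertices lie on threads with one or two interior
   vertices or on cycles [C_3], [C_4], [C_5] with a single branch vertex.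
   Giving [{1,2}] and 2 to all branch vertices is affordable except at "bad"
   vertices of degree 3; these get a single colour, chosen to minimise the number
   of monochromatic threads (a maximum cut), and the bad vertices of one of the
   two colours get a Roman value below 2. *)
Require Import Defs.
From mathcomp Require Import all_boot all_order all_algebra.
From mathcomp Require Import zify lra.

Set Implicit Arguments.
Unset Strict Implicit.
Unset Printing Implicit Defensive.

(** The bound is checked in thirds: each vertex owns 4 units, and a unit of either weight costs 3.
    [C_5] is the exception because it needs 3 + 4 = 7, that is 21 units against 20. A token charges
    this missing unit; a value 2 at its vertex saves one Roman unit in the [C_5] and turns the
    charge into a gain of 2. A branch vertex with [{1,2}] and 2 exceeds its budget by 8, while a
    neighbour of degree 2 or a token is only sure to bring 2, so degree 3 can fall short. With a
    single colour, a bad vertex has 1 unit to spare instead, but the middle vertex of a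
    monochromatic thread then needs a colour of its own, for 3 units. After a maximum cut each bad
    vertex has at most one such thread; this may still cost 3/2 per bad vertex where only 1 is
    available. Lowered Roman values, worth 3 units each, close the gap. Lowering both ends of a
    thread costs 3 again; lowering one colour class only confines this to monochromatic threads, and
    averaging over the two classes shows that one of them is affordable. *)

(** * Joint labellings, and their verification by computation on explicit lists *)

Section Labellings.

Variable T : finType.
Implicit Types (A K : {set T}) (e : rel T) (t : T -> nat) (u v w : T).

(* Two flags for the colours 1 and 2, and a Roman value. *)
Definition label : Type := (bool * bool) * nat.
Definition has1 (c : label) : bool := c.1.1.
Definition has2 (c : label) : bool := c.1.2.
Definition roman (c : label) : nat := c.2.
Definition weight (c : label) : nat := has1 c + has2 c + roman c.

Implicit Types L : T -> label.

Definition nbh A e u : {set T} := [set v in A | e u v].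

Definition rainbow_at A e L u : bool :=
  [|| has1 (L u), has2 (L u) |
      [exists v in nbh A e u, has1 (L v)] &&
      [exists v in nbh A e u, has2 (L v)]].

(* A token on [u] stands for a pendant [C_5] joined by a bridge to [u]: it costs
   3 for the rainbow function and 4 for the Roman one (3 when [u] has value 2),
   and if [u] has value 0 the attached vertex of the [C_5] may take value 2. In
   [affordable], the budget 4/3 * 5 of its vertices has been subtracted. *)
Definition roman_at A e t L u : bool :=
  [|| 0 < roman (L u), 0 < t u | [exists v in nbh A e u, roman (L v) == 2]].

Definition dominating A e t L : Prop :=
  forall u, u \in A -> rainbow_at A e L u /\ roman_at A e t L u.

Definition affordable A t L : Prop :=
  \sum_(v in A) (3 * weight (L v) + t v) <=
  \sum_(v in A) (4 + 3 * t v * (roman (L v) == 2)).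

Definition solvable A e t : Prop :=
  exists2 L, dominating A e t L & affordable A t L.

Definition no_token : T -> nat := fun=> 0.

Lemma in_nbh A e u v : (v \in nbh A e u) = (v \in A) && e u v.
Proof. by rewrite inE. Qed.

Lemma nbhS A A' e e' u : A \subset A' -> (forall v, e u v -> e' u v) ->
  nbh A e u \subset nbh A' e' u.
Proof.
move=> sA se; apply/subsetP => v; rewrite !in_nbh => /andP[vA /se ->].
by rewrite (subsetP sA).
Qed.

Lemma rainbow_atS A A' e e' L L' u :
  nbh A e u \subset nbh A' e' u -> L' u = L u ->
  {in nbh A e u, L' =1 L} -> rainbow_at A e L u -> rainbow_at A' e' L' u.
Proof.
move=> sN eqLu eqL; rewrite /rainbow_at eqLu.
case/or3P=> [->|->|/andP[/exists_inP[v vN v1] /exists_inP[w wN w2]]].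
- by [].
- by rewrite orbT.
- apply/or3P/Or33/andP; split; apply/exists_inP.
    by exists v; rewrite ?eqL // (subsetP sN).
  by exists w; rewrite ?eqL // (subsetP sN).
Qed.

Lemma roman_atS A A' e e' t L L' u :
  nbh A e u \subset nbh A' e' u -> L' u = L u ->
  {in nbh A e u, L' =1 L} -> roman_at A e t L u -> roman_at A' e' t L' u.
Proof.
move=> sN eqLu eqL; rewrite /roman_at eqLu.
case/or3P=> [->|->|/exists_inP[v vN v2]]; rewrite ?orbT //.
by apply/or3P/Or33/exists_inP; exists v; rewrite ?eqL // (subsetP sN).
Qed.

Lemma solvable_subrel A e e' t :
  (forall u v, e u v -> e' u v) -> solvable A e t -> solvable A e' t.
Proof.
move=> see' [L domL costL]; exists L => // u uA.
have sN : nbh A e u \subset nbh A e' u by apply: nbhS => //; apply: see'.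
have [rb ro] := domL u uA.
by split; [apply: rainbow_atS rb | apply: roman_atS ro].
Qed.

(** Edges between [K] and its complement only add neighbours, which never destroys domination, and
    the two budgets add up. *)
Lemma solvable_glue A K e t : K \subset A ->
  solvable K e t -> solvable (A :\: K) e t -> solvable A e t.
Proof.
move=> sKA [L1 dom1 cost1] [L2 dom2 cost2].
pose L w := if w \in K then L1 w else L2 w.
have L1E : {in K, L =1 L1} by move=> w wK; rewrite /L wK.
have L2E : {in A :\: K, L =1 L2} by move=> w /setDP[_ /negPf wK]; rewrite /L wK.
have sumK (F : T -> nat) :
    \sum_(v in A) F v = \sum_(v in K) F v + \sum_(v in A :\: K) F v.
  by rewrite (big_setID K) (setIidPr sKA).
exists L; last first.
  rewrite /affordable !sumK; apply: leq_add.
    by rewrite (eq_bigr (fun v => 3 * weight (L1 v) + t v)) => [|v /L1E ->//];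
       rewrite [leqRHS](eq_bigr (fun v => 4 + 3 * t v * (roman (L1 v) == 2)))
         => [|v /L1E ->].
  by rewrite (eq_bigr (fun v => 3 * weight (L2 v) + t v)) => [|v /L2E ->//];
     rewrite [leqRHS](eq_bigr (fun v => 4 + 3 * t v * (roman (L2 v) == 2)))
       => [|v /L2E ->].
move=> u uA; have [uK|uK] := boolP (u \in K).
  have [rb ro] := dom1 u uK.
  have sN : nbh K e u \subset nbh A e u by apply: nbhS.
  have eqL : {in nbh K e u, L =1 L1}.
    by move=> w; rewrite in_nbh => /andP[/L1E].
  by split; [apply: rainbow_atS rb | apply: roman_atS ro] => //; apply: L1E.
have uAK : u \in A :\: K by rewrite inE uK.
have [rb ro] := dom2 u uAK.
have sN : nbh (A :\: K) e u \subset nbh A e u by apply: nbhS; rewrite ?subsetDl.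
have eqL : {in nbh (A :\: K) e u, L =1 L2}.
  by move=> w; rewrite in_nbh => /andP[/L2E].
by split; [apply: rainbow_atS rb | apply: roman_atS ro] => //; apply: L2E.
Qed.

(** Explicit labels form a list parallel to a list of vertices, so that domination among them
    becomes a computation on positions. *)
Definition relabel (s : seq T) (l : seq label) L w : label :=
  if w \in s then nth (L w) l (index w s) else L w.

Lemma relabel_out s l L w : w \notin s -> relabel s l L w = L w.
Proof. by rewrite /relabel => /negPf ->. Qed.

Lemma relabel_nth s l L v0 i : uniq s -> size l = size s -> i < size s ->
  relabel s l L (nth v0 s i) = nth (false, false, 0) l i.
Proof.
move=> us szl lti; rewrite /relabel mem_nth // index_uniq //.
by apply: set_nth_default; rewrite szl.
Qed.

Lemma sum_relabel (F : T -> label -> nat) (G : label -> nat) s l L :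
  uniq s -> size l = size s -> (forall w, w \in s -> F w =1 G) ->
  \sum_(v in [set x in s]) F v (relabel s l L v) = \sum_(c <- l) G c.
Proof.
move=> us szl FG; rewrite (eq_bigl (mem s)); last by move=> v; rewrite !inE.
rewrite -big_uniq //= big_seq.
rewrite (eq_bigr (fun v => G (relabel s l L v))) => [|v vs]; last by rewrite FG.
rewrite -big_seq; case: s us szl {FG} => [|v0 s] us szl.
  by case: l szl => // _; rewrite !big_nil.
rewrite (big_nth v0) (big_nth (false, false, 0)) szl.
by apply: eq_big_nat => i /andP[_ lti]; rewrite relabel_nth.
Qed.

(* [E] lists pairs of positions holding adjacent vertices. *)
Definition adj_in (E : seq (nat * nat)) i j : bool :=
  ((i, j) \in E) || ((j, i) \in E).

Definition rainbow_check (l : seq label) E i : bool :=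
  let c := nth (false, false, 0) l in
  [|| has1 (c i), has2 (c i) |
     has (fun j => adj_in E i j && has1 (c j)) (iota 0 (size l)) &&
     has (fun j => adj_in E i j && has2 (c j)) (iota 0 (size l))].

Definition roman_check (l : seq label) E i : bool :=
  let c := nth (false, false, 0) l in
  (0 < roman (c i)) ||
  has (fun j => adj_in E i j && (roman (c j) == 2)) (iota 0 (size l)).

Section OnList.

Variables (A : {set T}) (e : rel T) (t : T -> nat) (L : T -> label).
Variables (s : seq T) (l : seq label) (E : seq (nat * nat)) (v0 : T).
Hypothesis e_sym : symmetric e.
Hypothesis us : uniq s.
Hypothesis szl : size l = size s.
Hypothesis sA : {subset s <= A}.
Hypothesis eE : all
  (fun ij => [&& ij.1 < size s, ij.2 < size s & e (nth v0 s ij.1) (nth v0 s ij.2)]) E.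

Lemma adj_inP i j : adj_in E i j -> [/\ i < size s, j < size s &
  e (nth v0 s i) (nth v0 s j)].
Proof.
by case/orP=> /(allP eE) /and3P[/= lti ltj eij]; split=> //; rewrite e_sym.
Qed.

Lemma adj_in_exists (P : pred label) i :
  has (fun j => adj_in E i j && P (nth (false, false, 0) l j)) (iota 0 (size l)) ->
  [exists v in nbh A e (nth v0 s i), P (relabel s l L v)].
Proof.
case/hasP=> j _ /andP[/adj_inP[lti ltj eij] Pj].
apply/exists_inP; exists (nth v0 s j); last by rewrite relabel_nth.
by rewrite in_nbh eij sA ?mem_nth.
Qed.

Lemma rainbow_checkP i : i < size s -> rainbow_check l E i ->
  rainbow_at A e (relabel s l L) (nth v0 s i).
Proof.
move=> lti; rewrite /rainbow_check /rainbow_at relabel_nth //.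
case/or3P=> [->|->|/andP[h1 h2]]; rewrite ?orbT //.
by rewrite !adj_in_exists ?orbT.
Qed.

Lemma roman_checkP i : i < size s -> roman_check l E i ->
  roman_at A e t (relabel s l L) (nth v0 s i).
Proof.
move=> lti; rewrite /roman_check /roman_at relabel_nth //.
case/orP=> [->|h] //.
by rewrite (adj_in_exists (P := fun c => roman c == 2)) ?orbT.
Qed.

End OnList.

Lemma solvable_list e s l E v0 : symmetric e -> uniq s -> size l = size s ->
  all (fun ij => [&& ij.1 < size s, ij.2 < size s &
                    e (nth v0 s ij.1) (nth v0 s ij.2)]) E ->
  all (fun i => rainbow_check l E i && roman_check l E i) (iota 0 (size s)) ->
  3 * sumn (map weight l) <= 4 * size s ->
  solvable [set x in s] e no_token.
Proof.
move=> e_sym us szl eE chk cost.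
have sA : {subset s <= [set x in s]} by move=> x; rewrite inE.
exists (relabel s l (fun=> (false, false, 0))); last first.
  rewrite /affordable.
  rewrite (sum_relabel (F := fun v c => 3 * weight c + no_token v)
             (G := fun c => 3 * weight c)) => // [|w _ c]; last by rewrite addn0.
  rewrite [leqRHS](eq_bigr (fun=> 4)) => [|v _]; last by rewrite /no_token muln0 mul0n addn0.
  rewrite sum_nat_const cardsE (card_uniqP us) -big_distrr /=.
  by rewrite mulnC -(big_map weight xpredT id) -sumnE mulnC (mulnC (size s)).
move=> u; rewrite inE => us'; rewrite -(nth_index v0 us').
have lti : index u s < size s by rewrite index_mem.
have /(allP chk)/andP[rb ro] : index u s \in iota 0 (size s) by rewrite mem_iota.
by split; [apply: rainbow_checkP rb | apply: roman_checkP ro].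
Qed.

End Labellings.
Arguments no_token {T} _.

(** * Branch vertices, and the vertices at distance two or more from them *)

Section Branches.

Variables (T : finType) (A : {set T}) (e : rel T) (t : T -> nat).
Implicit Types (u v w x y : T).

(* Tokens count for the degree, as the bridges they stand for. *)
Definition tdeg v : nat := #|nbh A e v| + t v.

Definition branch v : bool := (v \in A) && (2 < tdeg v).

Definition inner y : bool :=
  [&& y \in A, ~~ branch y & [forall v in nbh A e y, ~~ branch v]].

(** Meant for [y] opposite to [v] on a [C_4] (with [y'] equal to [y]), or one of the two vertices
    far from [v] on a [C_5] (with [y'] the other). The neighbours [x] and [x'] of [v] on the cycle
    show that tails come in pairs; the last clause makes [v] the only branch vertex that can dictate
    a colour to [y]. *)
Definition inner_hub y : Prop :=
  exists v, [/\ branch v,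
    exists x x' y', [/\ x \in A, x' \in A & x != x'] /\
      [/\ e y x, e x v, e v x', e x' y' & inner y'] &
    forall x1 v1, x1 \in A -> e y x1 -> e x1 v1 -> branch v1 -> v1 = v].

End Branches.

(** * Pairwise nonadjacent branch vertices: discharging and a maximum cut *)

Section Final.

Variables (T : finType) (A : {set T}) (e : rel T) (t : T -> nat).
Implicit Types (u v w x y : T).

Notation nb := (nbh A e).
Notation deg := (tdeg A e t).
Notation branch := (branch A e t).
Notation inner := (inner A e t).

Hypothesis e_sym : symmetric e.
Hypothesis deg_ge2 : forall v, v \in A -> 1 < deg v.
Hypothesis token_branch : forall v, v \in A -> 0 < t v -> 2 < deg v.
Hypothesis branch_indep : forall u v, branch u -> branch v -> ~~ e u v.
Hypothesis inner_hubP : forall y, inner y -> inner_hub A e t y.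

Lemma mem_nbh_sym u v : u \in A -> v \in A -> (u \in nb v) = (v \in nb u).
Proof. by move=> uA vA; rewrite !in_nbh uA vA e_sym. Qed.

Lemma nbhP u v : v \in nb u -> v \in A /\ e u v.
Proof. by rewrite in_nbh => /andP. Qed.

Lemma branchA v : branch v -> v \in A. Proof. by case/andP. Qed.

Lemma token0 v : v \in A -> ~~ branch v -> t v = 0.
Proof.
move=> vA; rewrite /branch vA /=; case: (posnP (t v)) => // tv.
by rewrite token_branch.
Qed.

Lemma nbh_pair x : x \in A -> ~~ branch x ->
  exists p q, [/\ p != q, nb x = [set p; q], p \in A & q \in A].
Proof.
move=> xA nbx; have /eqP : #|nb x| = 2.
  move: (token0 xA nbx) (deg_ge2 xA) (nbx); rewrite /branch xA /tdeg /=.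
  by move=> ->; rewrite !addn0; lia.
case/cards2P=> p [q [pq nx]]; exists p, q; split=> //.
  by have /nbhP[] : p \in nb x by rewrite nx !inE eqxx.
by have /nbhP[] : q \in nb x by rewrite nx !inE eqxx orbT.
Qed.

(* [link]s are the middle vertices of threads of length 2, [tail]s the neighbours
   of the branch vertex on a [C_4] or [C_5]. *)
Definition link x : bool :=
  [&& x \in A, ~~ branch x & [forall v in nb x, branch v]].

Definition tail x : bool :=
  [&& x \in A, ~~ branch x & [exists y in nb x, inner y]].

(** [{1,2}] and 2 cost 12, which is 8 above the budget of the vertex. Each neighbour sends at least
    2 and each token nets 3 - 1 = 2, so degree 4 suffices, and so does degree 3 if a neighbour that
    is neither link nor tail sends 4. *)
Definition good v : bool :=
  (3 < deg v) || [exists x in nb v, ~~ link x && ~~ tail x].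

Definition bad v : bool := branch v && ~~ good v.

(** The candidates for a Roman value below 2. Their neighbours are links, which have a second branch
    neighbour to rely on. With two tokens, dropping from 2 to 0 would save 6 and lose 6. *)
Definition clean v : bool :=
  [&& bad v, [forall x in nb v, link x] & t v <= 1].

Definition mono (c : T -> bool) x : bool :=
  link x && [forall v in nb x, [forall w in nb x, bad v && (c v == c w)]].

Lemma nb_branch v x : branch v -> x \in nb v -> ~~ branch x.
Proof. by move=> bv /nbhP[_ evx]; apply/negP => /(branch_indep bv)/negP. Qed.

Lemma bad_deg v : bad v -> deg v = 3.
Proof. by rewrite /bad /branch /good; case: (v \in A) => //=; lia. Qed.

Lemma bad_nb v x : bad v -> x \in nb v -> link x || tail x.
Proof.
case/andP=> _ /norP[_ /exists_inPn h] /h; by rewrite negb_and !negbK.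
Qed.

Lemma inner_notlink x y : inner y -> y \in nb x -> ~~ link x.
Proof.
case/and3P=> _ nby _ yx; apply/negP => /and3P[_ _ /forall_inP/(_ y yx)].
by rewrite (negPf nby).
Qed.

Lemma link_pair x : link x -> exists p q,
  [/\ p != q, nb x = [set p; q], branch p & branch q].
Proof.
case/and3P=> xA nbx /forall_inP lx.
have [p [q [pq nx _ _]]] := nbh_pair xA nbx.
by exists p, q; split=> //; apply: lx; rewrite nx !inE eqxx ?orbT.
Qed.

Lemma mono_pair c x : mono c x -> exists p q,
  [/\ p != q, nb x = [set p; q], bad p, bad q & c p = c q].
Proof.
case/andP=> /link_pair[p [q [pq nx _ _]]] /forall_inP mx; exists p, q.
have px : p \in nb x by rewrite nx !inE eqxx.
have qx : q \in nb x by rewrite nx !inE eqxx orbT.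
have /forall_inP/(_ q qx)/andP[bp /eqP cpq] := mx p px.
by have /forall_inP/(_ p px)/andP[bq _] := mx q qx.
Qed.

Lemma pair_mono c x p q : link x -> nb x = [set p; q] -> bad p -> bad q ->
  c p = c q -> mono c x.
Proof.
move=> lx nx bp bq cpq; rewrite /mono lx /=.
apply/forall_inP => v; rewrite nx => /set2P vpq.
apply/forall_inP => w /set2P wpq.
by case: vpq => ->; case: wpq => ->; rewrite ?bp ?bq ?cpq eqxx.
Qed.

(* Compare [c] with the colouring obtained by flipping the colour of [v]. *)
Lemma flip_mono c v : bad v ->
  (forall c' : {ffun T -> bool}, #|[set x in A | mono c x]| <= #|[set x in A | mono c' x]|) ->
  2 * #|[set x in nb v | mono c x]| <= #|[set x in nb v | link x]|.
Proof.
move=> bv /(_ [ffun w => c w (+) (w == v)]).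
set c' := [ffun w => _]; set X := [set x in A | mono c x].
set X' := [set x in A | mono c' x] => minX.
have vA : v \in A by case/andP: bv => /branchA.
have outside : X :\: nb v = X' :\: nb v.
  apply/setP => x; rewrite !inE; case xA: (x \in A) => //=.
  have [evx|nevx] := boolP (e v x); rewrite //=.
  rewrite /mono; case: (link x) => //=.
  have c'E w : w \in nb x -> c' w = c w.
    move=> /nbhP[_ exw]; rewrite /c' ffunE.
    have [wv|] := eqVneq w v; last by rewrite addbF.
    by rewrite e_sym -wv exw in nevx.
  apply: eq_forallb_in => p px; apply: eq_forallb_in => q qx.
  by rewrite !c'E.
have inside : X' :&: nb v \subset [set x in nb v | link x] :\: [set x in nb v | mono c x].
  apply/subsetP => x /setIP[]; rewrite inE => /andP[xA m'x] xv.
  have /andP[lx _] := m'x.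
  apply/setDP; split; first by rewrite inE xv lx.
  apply/negP; rewrite inE xv /= => mx.
  have [p [q [pq nx bp bq cpq]]] := mono_pair mx.
  have [p' [q' [pq' nx' _ _ cpq']]] := mono_pair m'x.
  have c'pq : c' p = c' q.
    have : p \in [set p'; q'] by rewrite -nx' nx !inE eqxx.
    have : q \in [set p'; q'] by rewrite -nx' nx !inE eqxx orbT.
    by case/set2P=> ->; case/set2P=> ->; rewrite ?cpq'.
  have : v \in nb x by rewrite mem_nbh_sym.
  rewrite nx => /set2P[] vE; move: c'pq; rewrite /c' !ffunE -vE eqxx vE cpq.
    by rewrite eq_sym (negPf pq); case: (c q).
  by rewrite (negPf pq); case: (c q).
have sub : [set x in nb v | mono c x] \subset [set x in nb v | link x].
  by apply/subsetP => x; rewrite !inE => /andP[-> /andP[-> _]].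
have XI : X :&: nb v = [set x in nb v | mono c x].
  by apply/setP => x; rewrite !inE; case: (x \in A) => //=; rewrite andbC.
move: minX (subset_leq_card inside) (subset_leq_card sub).
rewrite -(cardsID (nb v) X) -(cardsID (nb v) X') outside XI (cardsD [set x in nb v | link x]).
by rewrite (setIidPr sub); lia.
Qed.

(** Half of at most three links is at most one. If [v] is not clean, then either two tokens leave it
    at most one neighbour, or it has a tail; by [inner_hub] two of its neighbours are then no links,
    so at most one link remains, and half of one rounds down to zero. *)
Lemma flip_clean c v : bad v ->
  2 * #|[set x in nb v | mono c x]| <= #|[set x in nb v | link x]| ->
  #|[set x in nb v | mono c x]| <= clean v.
Proof.
move=> bv flip; have := bad_deg bv; rewrite /tdeg => degv.
have sub : [set x in nb v | link x] \subset nb v.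
  by apply/subsetP => x; rewrite inE => /andP[].
have := subset_leq_card sub; rewrite /clean bv /=.
have [tv|tv] := leqP (t v) 1; last by rewrite andbF /=; lia.
rewrite andbT; have [_|] := boolP [forall x in nb v, link x] => /=; first lia.
case/forall_inPn=> x xv nlx; have := bad_nb bv xv; rewrite (negPf nlx) /=.
case/and3P=> xA _ /exists_inP[y /nbhP[yA exy] iny] _.
have [w [bw [x1 [x2 [y2 [[x1A x2A x12] [eyx1 ex1w ewx2 ex2y' iny']]]]] uniqw]] := inner_hubP iny.
have vA : v \in A by case/andP: bv => /branchA.
have vw : v = w.
  have [_ evx] := nbhP xv; case/andP: (bv) => brv _.
  by apply: (uniqw x) => //; rewrite e_sym.
subst w.
have sub2 : [set x in nb v | link x] \subset nb v :\: [set x1; x2].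
  apply/subsetP => z; rewrite inE => /andP[zv lz]; rewrite inE zv andbT.
  apply: contraL lz => /set2P[]->.
    by apply: (inner_notlink iny); rewrite in_nbh yA e_sym.
  apply: (inner_notlink iny'); rewrite in_nbh ex2y' andbT.
  by case/and3P: iny'.
have sub3 : [set x1; x2] \subset nb v.
  by apply/subsetP => z /set2P[]->; rewrite in_nbh ?x1A ?x2A //= e_sym.
have := subset_leq_card sub2; rewrite cardsD (setIidPr sub3) cards2 x12.
move: flip degv; clear; lia.
Qed.

(* Discharging: vertices of degree 2 send their budget of 4 to branch vertices
   and to inner vertices. *)
Definition pay x v : nat :=
  if branch x then 0 else
  if branch v then (if link x || tail x then 2 else 4) else
  if inner v && ~~ inner x then 2 else 0.

Lemma sum_pay : \sum_(x in A) \sum_(v in nb x) pay x v =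
                \sum_(v in A) \sum_(x in nb v) pay x v.
Proof.
rewrite (exchange_big_dep (mem A)) /=; last by move=> x v _ /nbhP[].
apply: eq_bigr => v vA; apply: eq_bigl => x; rewrite !in_nbh vA /=.
by rewrite e_sym.
Qed.

Lemma sum_pair (F : T -> nat) x p q : p != q -> nb x = [set p; q] ->
  \sum_(v in nb x) F v = F p + F q.
Proof.
by move=> pq ->; rewrite big_setU1 ?big_set1 // inE.
Qed.

Lemma pay_out x : x \in A -> \sum_(v in nb x) pay x v <= (~~ branch x) * 4.
Proof.
move=> xA; have [bx|nbx] := boolP (branch x).
  by rewrite big1 // => v _; rewrite /pay bx.
rewrite mul1n.
have [p [q [pq nx pA qA]]] := nbh_pair xA nbx.
rewrite (sum_pair _ pq nx) /pay (negPf nbx).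
have px : p \in nb x by rewrite nx !inE eqxx.
have qx : q \in nb x by rewrite nx !inE eqxx orbT.
have innerE : inner x = ~~ branch p && ~~ branch q.
  rewrite /inner xA nbx /=; apply/forall_inP/andP => [h|[hp hq] z].
    by split; apply: h.
  by rewrite nx => /set2P[]->.
have linkE : link x = branch p && branch q.
  rewrite /link xA nbx /=; apply/forall_inP/andP => [h|[hp hq] z].
    by split; apply: h.
  by rewrite nx => /set2P[]->.
have tailE : tail x = inner p || inner q.
  rewrite /tail xA nbx /=; apply/exists_inP/orP => [[z]|].
    by rewrite nx => /set2P[]->; [left | right].
  by case=> h; [exists p | exists q].
rewrite innerE linkE tailE.
by case: (branch p); case: (branch q); case: (inner p); case: (inner q).
Qed.

Lemma pay_in_branch v : branch v -> 2 * #|nb v| <= \sum_(x in nb v) pay x v.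
Proof.
move=> bv; rewrite mulnC -sum_nat_const; apply: leq_sum => x xv.
by rewrite /pay (negPf (nb_branch bv xv)) bv; case: ifP.
Qed.

Lemma pay_in_good v : branch v -> good v ->
  8 <= \sum_(x in nb v) pay x v + 2 * t v.
Proof.
move=> bv /orP[|]; first by have := pay_in_branch bv; rewrite /tdeg; lia.
case/exists_inP=> x xv /andP[nlx ntx].
rewrite (bigD1 x) //= {1}/pay (negPf (nb_branch bv xv)) bv (negPf nlx) (negPf ntx).
have : 2 * #|nb v :\ x| <= \sum_(i in nb v | i != x) pay i v.
  rewrite mulnC -sum_nat_const.
  rewrite [leqLHS](eq_bigl (fun i => (i \in nb v) && (i != x))); last first.
    by move=> i; rewrite !inE andbC.
  apply: leq_sum => i /andP[iv _].
  by rewrite /pay (negPf (nb_branch bv iv)) bv; case: ifP.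
have := cardsD1 x (nb v); rewrite xv.
have : 2 < deg v by case/andP: bv.
rewrite /tdeg /=; clear; lia.
Qed.

Lemma pay_in_inner y : inner y -> 2 <= \sum_(x in nb y) pay x y.
Proof.
move=> iny; have [w [bw [x [_ [_ [[xA _ _] [eyx exw _ _ _]]]]] _]] := inner_hubP iny.
case/and3P: (iny) => yA nby /forall_inP h.
have xy : x \in nb y by rewrite in_nbh xA.
rewrite (bigD1 x) //= {1}/pay (negPf (h x xy)) (negPf nby) iny /=.
suff -> : inner x = false by rewrite /=; clear; lia.
apply/negP => /and3P[_ _ /forall_inP/(_ w)].
by rewrite in_nbh exw (branchA bw) bw => /(_ isT).
Qed.

Section Choice.

Variables (c : T -> bool) (beta : bool).

Definition low v : bool := clean v && (c v == beta).

(** Opposite to the only branch vertex two steps away, so that the tail between them sees both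
    colours. At an inner vertex the default [y] is never reached. *)
Definition inner_colour y : bool :=
  ~~ c (odflt y [pick v | branch v && [exists x in nb y, e x v]]).

Definition blocked x : bool := link x && [forall v in nb x, low v].

(** The truncated [1 - t w] is 1 without a token and 0 with one. Both save 3 units: dropping from 2
    to 0 saves 6, but the token loses its rebate of 3. *)
Definition final_label w : label :=
  if branch w then
    if good w then (true, true, 2)
    else (c w, ~~ c w, if low w then 1 - t w else 2)
  else if inner w then (inner_colour w, ~~ inner_colour w, 1)
  else (mono c w, false, nat_of_bool (blocked w)).

Lemma inner_colourE y x v : inner y -> x \in nb y -> e x v -> branch v ->
  inner_colour y = ~~ c v.
Proof.
move=> iny xy exv bv; rewrite /inner_colour; case: pickP => [w|] /=.
  case/andP=> bw /exists_inP[x' x'y ex'w].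
  have [u [_ _ uniqu]] := inner_hubP iny.
  have [xA eyx] := nbhP xy; have [x'A eyx'] := nbhP x'y.
  by rewrite (uniqu x v) // (uniqu x' w).
move=> /(_ v); rewrite bv /=; have -> // : [exists x0 in nb y, e x0 v].
by apply/exists_inP; exists x.
Qed.

Lemma low_bad v : low v -> bad v.
Proof. by case/andP=> /and3P[]. Qed.

(** A vertex neither branch nor inner has a branch neighbour [z]. A good [z] provides everything.
    Otherwise the vertex is a link, whose other end is good or of the other colour unless it is
    [mono], or a tail, whose inner neighbour has the other colour. Low vertices see only links, so
    the value 2 is missing only at links with two low ends, the [blocked] ones. *)
Lemma final_dominating : dominating A e t final_label.
Proof.
move=> w wA; rewrite /rainbow_at /roman_at /=.
have [bw|nbw] := boolP (branch w).
  rewrite /final_label bw; case: (good w) => //=; rewrite /has1 /has2 /roman /=.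
  by split; [case: (c w) | case: (low w); case: (t w)].
have [iw|niw] := boolP (inner w).
  by rewrite /final_label (negPf nbw) iw /has1 /has2 /=; case: (inner_colour w).
have [p [q [pq nw pA qA]]] := nbh_pair wA nbw.
have pw : p \in nb w by rewrite nw !inE eqxx.
have qw : q \in nb w by rewrite nw !inE eqxx orbT.
have colour v : v \in nb w -> branch v -> ~~ good v ->
    has1 (final_label v) = c v /\ has2 (final_label v) = ~~ c v.
  by move=> _ bv ngv; rewrite /final_label bv (negPf ngv).
have full v : branch v -> good v -> has1 (final_label v) && has2 (final_label v).
  by move=> bv gv; rewrite /final_label bv gv.
have conv v u : v \in nb w -> u \in nb w ->
    has1 (final_label v) -> has2 (final_label u) ->
    [exists v in nb w, has1 (final_label v)] &&
    [exists v in nb w, has2 (final_label v)].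
  by move=> vw uw h1 h2; apply/andP; split; apply/exists_inP; [exists v | exists u].
have opp v u : v \in nb w -> u \in nb w ->
    has1 (final_label v) = ~~ has1 (final_label u) ->
    has2 (final_label v) = ~~ has2 (final_label u) ->
    has1 (final_label u) = ~~ has2 (final_label u) ->
    [exists v in nb w, has1 (final_label v)] &&
    [exists v in nb w, has2 (final_label v)].
  move=> vw uw h1 h2 h3; case E: (has2 (final_label u)).
    by apply: (conv v u) => //; rewrite h1 h3 E.
  by apply: (conv u v) => //; rewrite ?h2 ?h3 E.
have [z zw bz] : exists2 z, z \in nb w & branch z.
  by move: niw; rewrite /inner wA nbw /= => /forall_inPn[z zw]; rewrite negbK; exists z.
have wz : w \in nb z by rewrite mem_nbh_sym // branchA.
split.
  have [mw|nmw] := boolP (mono c w).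
    by rewrite /final_label (negPf nbw) (negPf niw) /has1 /= mw.
  suff -> : [exists v in nb w, has1 (final_label v)] &&
            [exists v in nb w, has2 (final_label v)] by rewrite !orbT.
  have [gz|ngz] := boolP (good z).
    by have /andP[h1 h2] := full z bz gz; apply: (conv z z).
  have badz : bad z by rewrite /bad bz.
  have [h1z h2z] := colour z zw bz ngz.
  have [lw|nlw] := boolP (link w).
    have [y yw yz] : exists2 y, y \in nb w & y != z.
      have /set2P[->|->] : z \in [set p; q] by rewrite -nw.
        by exists q; rewrite // eq_sym.
      by exists p.
    have by_ : branch y by case/and3P: lw => _ _ /forall_inP/(_ y yw).
    have [gy|ngy] := boolP (good y).
      by have /andP[h1 h2] := full y by_ gy; apply: (conv y y).
    have [h1y h2y] := colour y yw by_ ngy.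
    have nzy : nb w = [set z; y].
      move: zw yw yz; rewrite nw => /set2P[]-> /set2P[]->; rewrite ?eqxx //.
      by move=> _; rewrite setUC.
    have cyz : c y = ~~ c z.
      apply: contraNeq nmw => ncyz; apply: (pair_mono lw nzy) => //.
        by rewrite /bad by_.
      by move: ncyz; case: (c y); case: (c z).
    by apply: (opp y z) => //; rewrite ?h1y ?h2y ?h1z ?h2z ?cyz ?negbK.
  have := bad_nb badz wz; rewrite (negPf nlw) /= => /and3P[_ _ /exists_inP[y yw iny]].
  have [yA ewy] := nbhP yw.
  have nby : ~~ branch y by case/and3P: iny.
  have yc : inner_colour y = ~~ c z.
    apply: (inner_colourE (x := w)) => //; last by case/nbhP: zw.
    by rewrite mem_nbh_sym.
  apply: (opp y z) => //; rewrite ?h1z ?h2z /final_label ?(negPf nby) ?iny /has1 /has2 /=.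
  - by rewrite yc.
  - by rewrite yc.
  - by rewrite negbK.
have two v : v \in nb w -> branch v -> ~~ low v -> 
    [exists v in nb w, roman (final_label v) == 2].
  move=> vw bv nlv; apply/exists_inP; exists v => //.
  by rewrite /final_label bv (negPf nlv); case: (good v).
have [lz|nlz] := boolP (low z); last by rewrite (two z) ?orbT.
have lw : link w by case/andP: lz => /and3P[_ /forall_inP/(_ w wz)].
have [bw|] := boolP (blocked w).
  by rewrite /final_label (negPf nbw) (negPf niw) /roman /= bw.
rewrite /blocked lw /= => /forall_inPn[v vw nlv].
rewrite (two v) ?orbT //.
by case/and3P: lw => _ _ /forall_inP/(_ v vw).
Qed.

(** A bad vertex of value 2 spends 9 against its own 4 and 2 for each of its three neighbours and
    tokens, hence the surplus [bad w]. The term [low] records the 3 units saved, [mono] and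
    [blocked] the 3 units that each adds to a link. *)
Lemma final_balance w : w \in A ->
  3 * weight (final_label w) + t w + \sum_(v in nb w) pay w v +
    (bad w + 3 * low w) <=
  4 + 3 * t w * (roman (final_label w) == 2) + \sum_(x in nb w) pay x w +
    (3 * mono c w + 3 * blocked w).
Proof.
move=> wA; have := pay_out wA.
have [bw|nbw] := boolP (branch w).
  rewrite mul0n leqn0 => /eqP->; have := pay_in_branch bw.
  rewrite /final_label /bad bw /=.
  have [gw|ngw] := boolP (good w).
    have := pay_in_good bw gw.
    have -> : low w = false by apply/negP => /low_bad; rewrite /bad gw andbF.
    by rewrite /weight /has1 /has2 /roman /=; lia.
  have badw : bad w by rewrite /bad bw.
  have := bad_deg badw; rewrite /tdeg.
  have wc : c w + ~~ c w = 1 by case: (c w).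
  rewrite /weight /has1 /has2 /roman /= wc.
  have [lw|nlw] := boolP (low w); last by rewrite eqxx; lia.
  have tw : t w <= 1 by case/andP: lw => /and3P[].
  by case: (t w) tw => [|[]] //= _; lia.
have tw := token0 wA nbw; rewrite tw mul1n.
have -> : low w = false.
  by apply/negP => /low_bad; rewrite /bad (negPf nbw).
rewrite /bad /final_label (negPf nbw) /=.
have [iw|niw] := boolP (inner w).
  have := pay_in_inner iw.
  have wc : inner_colour w + ~~ inner_colour w = 1 by case: (inner_colour w).
  rewrite /weight /has1 /has2 /roman /= wc.
  suff -> : \sum_(v in nb w) pay w v = 0 by lia.
  apply: big1 => v vw; rewrite /pay iw andbF.
  by case/and3P: iw => _ _ /forall_inP/(_ v vw)/negPf ->; case: ifP.
by rewrite /weight /has1 /has2 /roman /=; lia.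
Qed.

End Choice.

Lemma independent_solvable : solvable A e t.
Proof.
have [c _ minc] : exists2 c : {ffun T -> bool}, true &
    forall c' : {ffun T -> bool},
      #|[set x in A | mono c x]| <= #|[set x in A | mono c' x]|.
  by case: (arg_minnP (P := xpredT) (i0 := [ffun=> true])
    (fun c : {ffun T -> bool} => #|[set x in A | mono c x]|)) => // c _ h;
    exists c => // c'; apply: h.
set M := \sum_(x in A) (mono c x : nat).
set C := \sum_(v in A) (clean v : nat).
set D := \sum_(v in A) (bad v : nat).
pose S b := \sum_(v in A) (low c b v : nat).
pose MS b := \sum_(x in A) (blocked c b x : nat).
(* Double counting of monochromatic links and their ends: both ends are bad, and a bad end [v] has
   at most [clean v] such links. *)
have MC : 2 * M <= C.
  have -> : 2 * M = \sum_(v in A) \sum_(x in nb v) (mono c x && bad v).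
    rewrite (exchange_big_dep (mem A)) /=; last by move=> x v _ /nbhP[].
    rewrite /M big_distrr /=; apply: eq_bigr => x xA.
    rewrite (eq_bigl (mem (nb x))) => [|v]; last by rewrite /= !in_nbh xA e_sym.
    have [mx|_] := boolP (mono c x); last by rewrite big1.
    have [p [q [pq nx bp bq _]]] := mono_pair mx.
    by rewrite (sum_pair _ pq nx) bp bq.
  apply: leq_sum => v vA; have [bv|nbv] := boolP (bad v); last first.
    by rewrite big1 // => x _; rewrite andbF.
  apply: leq_trans (flip_clean bv (flip_mono bv minc)).
  rewrite -sum1_card big_mkcond [leqRHS]big_mkcond /=; apply: leq_sum => x _.
  by rewrite [x \in [set _ in _ | _]]inE; case: (x \in nb v); case: (mono c x).
have CD : C <= D by apply: leq_sum => v _; rewrite /clean; case: (bad v); rewrite /= ?leq_b1.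
have SC : S true + S false = C.
  rewrite -big_split; apply: eq_bigr => v _ /=; rewrite /low.
  by case: (clean v); case: (c v).
(* Both ends of a blocked link have colour [b], so it is monochromatic, and it is blocked for only
   one value of [b]. *)
have MSM : MS true + MS false <= M.
  rewrite -big_split; apply: leq_sum => x _ /=.
  have blockedM b : blocked c b x -> mono c x /\ [exists v in nb x, c v == b].
    case/andP=> lx /forall_inP h; have [p [q [pq nx bp bq]]] := link_pair lx.
    have px : p \in nb x by rewrite nx !inE eqxx.
    have qx : q \in nb x by rewrite nx !inE eqxx orbT.
    have lp := h p px; have lq := h q qx; split; last first.
      by apply/exists_inP; exists p; case/andP: lp.
    apply: (pair_mono lx nx); try exact: low_bad lp; try exact: low_bad lq.
    by case/andP: lp => _ /eqP ->; case/andP: lq => _ /eqP ->.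
  have [bt|_] := boolP (blocked c true x); have [bf|_] := boolP (blocked c false x) => //.
  - case/andP: bt bf => lx /forall_inP ht /andP[_ /forall_inP hf].
    have [p [q [pq nx bp bq]]] := link_pair lx.
    have px : p \in nb x by rewrite nx !inE eqxx.
    case/andP: (ht p px) => _ /eqP cp; case/andP: (hf p px) => _.
    by rewrite cp.
  - by have [-> _] := blockedM true bt.
  - by have [-> _] := blockedM false bf.
have total b : \sum_(w in A) (3 * weight (final_label c b w) + t w) +
    (D + 3 * S b) <=
    \sum_(w in A) (4 + 3 * t w * (roman (final_label c b w) == 2)) +
    (3 * M + 3 * MS b).
  have : \sum_(w in A)
      (3 * weight (final_label c b w) + t w + \sum_(v in nb w) pay w v +
        (bad w + 3 * low c b w)) <=
    \sum_(w in A) (4 + 3 * t w * (roman (final_label c b w) == 2) +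
        \sum_(x in nb w) pay x w + (3 * mono c w + 3 * blocked c b w)).
    by apply: leq_sum => w; apply: final_balance.
  rewrite [leqLHS]big_split [leqRHS]big_split /=.
  rewrite [X in X + _ <= _]big_split [X in _ <= X + _]big_split /=.
  rewrite [X in _ + X <= _]big_split [X in _ <= _ + X]big_split /= sum_pay.
  rewrite -!big_distrr /= -/D -/(S b) -/M -/(MS b).
  by lia.
(* If both failed, adding them would give [2 * D + 3 * C < 9 * M], whereas
   [2 * D + 3 * C >= 5 * C >= 10 * M]. *)
have [h|h] : D + 3 * S true >= 3 * M + 3 * MS true \/
             D + 3 * S false >= 3 * M + 3 * MS false by lia.
  exists (final_label c true); first exact: final_dominating.
  by rewrite /affordable; have := total true; lia.
exists (final_label c false); first exact: final_dominating.
by rewrite /affordable; have := total false; lia.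
Qed.

End Final.

(** * Replacing pendant [C_5]s by tokens *)

Section Strip.

Variable T : finType.
Implicit Types (A K : {set T}) (e : rel T) (t : T -> nat) (u v w x y z : T).

Lemma card_set3 x y z : uniq [:: x; y; z] -> #|[set x; y; z]| = 3.
Proof.
move=> xyz; rewrite -[3]/(size [:: x; y; z]) -(card_uniqP xyz).
by apply: eq_card => w; rewrite !inE -orbA.
Qed.

Definition five_cycle A e t u v x y z s : Prop :=
  [/\ uniq [:: u; x; y; z; s; v], u \in A &
      {in [:: u; x; y; z; s], t =1 no_token}] /\
  [/\ nbh A e u = [set x; s; v], nbh A e x = [set u; y],
      nbh A e y = [set x; z], nbh A e z = [set y; s] &
      nbh A e s = [set z; u]].

Definition c5_root A e t u v : Prop :=
  exists x y z s, five_cycle A e t u v x y z s.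

Lemma strip_solvable A e t u v x y z s : symmetric e ->
  five_cycle A e t u v x y z s ->
  solvable (A :\: [set w in [:: u; x; y; z; s]]) e (fun w => t w + (w == v)) ->
  solvable A e t.
Proof.
move=> e_sym [[us uA tK] [nu nx ny nz ns]].
set sK := [:: u; x; y; z; s]; set K := [set w in sK].
have usK : uniq sK.
  by move: us; rewrite -[_ :: _]/(sK ++ [:: v]) cat_uniq => /andP[].
have [xA eux] : x \in A /\ e u x by apply: nbhP; rewrite nu !inE eqxx.
have [vA euv] : v \in A /\ e u v by apply: nbhP; rewrite nu !inE eqxx orbT.
have [yA exy] : y \in A /\ e x y by apply: nbhP; rewrite nx !inE eqxx orbT.
have [zA eyz] : z \in A /\ e y z by apply: nbhP; rewrite ny !inE eqxx orbT.
have [sA ezs] : s \in A /\ e z s by apply: nbhP; rewrite nz !inE eqxx orbT.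
have [_ esu] : u \in A /\ e s u by apply: nbhP; rewrite ns !inE eqxx orbT.
have sKA : {subset sK <= A}.
  by apply/allP; rewrite /= uA xA yA zA sA.
have vK : v \notin sK.
  by move: us; rewrite -[_ :: _]/(rcons sK v) rcons_uniq => /andP[].
case=> L domL costL; pose g2 := roman (L v) == 2.
(* If [v] has value 2 it dominates [u], and the cycle manages with 3 + 3. Otherwise the cycle takes
   3 + 4 with value 2 on [u], which then does for [v] what the new token did. *)
pose l : seq label := if g2 then
  [:: (true, false, 0); (false, false, 0); (false, true, 2); (false, true, 0);
      (false, false, 1)]
  else [:: (true, false, 2); (false, false, 0); (false, true, 1); (false, true, 1);
      (false, false, 0)].
have szl : size l = 5 by rewrite /l; case: (boolP g2).
pose E := [:: (0, 1); (1, 2); (2, 3); (3, 4); (4, 0)].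
have eE : all (fun ij => [&& ij.1 < size sK, ij.2 < size sK &
    e (nth v sK ij.1) (nth v sK ij.2)]) E.
  by rewrite /= eux exy eyz ezs esu.
pose L' := relabel sK l L.
have L'out w : w \notin sK -> L' w = L w by apply: relabel_out.
have vAK : v \in A :\: K by rewrite in_setD inE vK.
exists L'.
  move=> w wA; have [wK|wK] := boolP (w \in sK).
    have lti : index w sK < 5 by rewrite -[5]/(size sK) index_mem.
    have rbl : all (rainbow_check l E) (iota 0 5) by rewrite /l; case: (boolP g2).
    (* Position 0 is [u], which in the first case is dominated by [v], outside the list. *)
    have rol : all (fun i => (i == 0) && g2 || roman_check l E i) (iota 0 5).
      by rewrite /l; case: (boolP g2).
    have /(allP rbl) rb : index w sK \in iota 0 5 by rewrite mem_iota.
    have /(allP rol) ro : index w sK \in iota 0 5 by rewrite mem_iota.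
    rewrite -(nth_index v wK); split; first exact: (rainbow_checkP L e_sym usK szl sKA eE lti rb).
    case/orP: ro => [/andP[/eqP-> vg]|]; last exact: (roman_checkP t L e_sym usK szl sKA eE lti).
    rewrite /roman_at /=; apply/or3P/Or33/exists_inP; exists v.
      by rewrite in_nbh vA euv.
    by rewrite L'out.
  have wAK : w \in A :\: K by rewrite in_setD inE wK.
  have [rb ro] := domL w wAK.
  have sN : nbh (A :\: K) e w \subset nbh A e w by apply: nbhS; rewrite ?subsetDl.
  have eqL : {in nbh (A :\: K) e w, L' =1 L}.
    by move=> w' /nbhP[/setDP[_]]; rewrite inE => /L'out.
  split; first by apply: rainbow_atS rb; rewrite ?L'out.
  have [wv|wv] := eqVneq w v; last first.
    have : roman_at (A :\: K) e t L w by move: ro; rewrite /roman_at (negPf wv) addn0.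
    by apply: roman_atS => //; rewrite L'out.
  have [vg|nvg] := boolP g2.
    by rewrite /roman_at wv L'out // (eqP vg).
  rewrite /roman_at; apply/or3P/Or33/exists_inP; exists u.
    by rewrite in_nbh uA wv e_sym.
  by rewrite /L' /relabel /= inE eqxx /l (negPf nvg).
have sKs : K \subset A by apply/subsetP => w; rewrite inE; apply: sKA.
have sumK (F : T -> nat) :
    \sum_(w in A) F w = \sum_(w in K) F w + \sum_(w in A :\: K) F w.
  by rewrite (big_setID K) (setIidPr sKs).
have sumv (F : T -> nat) : \sum_(w in A :\: K) (w == v) * F w = F v.
  rewrite (bigD1 v) //= eqxx mul1n big1 ?addn0 // => w /andP[_ /negPf->].
  by rewrite mul0n.
rewrite /affordable !sumK.
have -> : \sum_(w in K) (3 * weight (L' w) + t w) = if g2 then 18 else 21.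
  rewrite (eq_bigr (fun w => 3 * weight (L' w))) => [|w]; last first.
    by rewrite inE => /tK ->; rewrite addn0.
  rewrite (sum_relabel (F := fun=> fun c => 3 * weight c)
             (G := fun c => 3 * weight c)) // /l.
  by case: (boolP g2); rewrite !big_cons big_nil.
have -> : \sum_(w in K) (4 + 3 * t w * (roman (L' w) == 2)) = 20.
  rewrite (eq_bigr (fun=> 4)) => [|w]; last first.
    by rewrite inE => /tK ->.
  by rewrite sum_nat_const /K cardsE (card_uniqP usK).
move: costL; rewrite /affordable.
under eq_bigr => w do rewrite addnA -[X in _ + X](muln1 (w == v)).
rewrite big_split /= (sumv (fun=> 1)).
have -> : \sum_(w in A :\: K) (4 + 3 * (t w + (w == v)) * (roman (L w) == 2)) =
    \sum_(w in A :\: K) (4 + 3 * t w * (roman (L w) == 2)) + 3 * g2.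
  rewrite -(sumv (fun w => 3 * (roman (L w) == 2))) -big_split /=.
  by apply: eq_bigr => w _; rewrite mulnDr mulnDl addnA mulnA (mulnC 3 (w == v)).
rewrite [X in _ -> _ + X <= _](eq_bigr (fun w => 3 * weight (L w) + t w)); last first.
  by move=> w /setDP[_]; rewrite inE => /L'out ->.
rewrite [X in _ -> _ <= _ + X](eq_bigr (fun w => 4 + 3 * t w * (roman (L w) == 2))); last first.
  by move=> w /setDP[_]; rewrite inE => /L'out ->.
by case: (boolP g2) => /=; clear; lia.
Qed.

(** The hypotheses of the independent case, relaxed to let branch vertices be adjacent across the
    bridge of a pendant [C_5]; stripping these cycles one at a time preserves it. *)
Definition reduced A e t : Prop :=
  [/\ forall v, v \in A -> 1 < tdeg A e t v,
      forall v, v \in A -> 0 < t v -> 2 < tdeg A e t v,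
      forall u v, branch A e t u -> branch A e t v -> e u v ->
        c5_root A e t u v \/ c5_root A e t v u &
      forall y, inner A e t y -> inner_hub A e t y].

(** Outside the cycle only [v] loses a neighbour, namely [u], and the new token restores its degree;
    branch and inner vertices there stay what they were. *)
Lemma strip_reduced A e t u v x y z s : symmetric e -> branch A e t v ->
  five_cycle A e t u v x y z s -> reduced A e t ->
  reduced (A :\: [set w in [:: u; x; y; z; s]]) e (fun w => t w + (w == v)).
Proof.
move=> e_sym bv [[us uA tK] [nu nx ny nz ns]] [deg2 tokb adj hub].
set sK := [:: u; x; y; z; s] in tK *; set K := [set w in sK].
set t' := fun w => _.
have vK : v \notin sK.
  by move: us; rewrite -[_ :: _]/(rcons sK v) rcons_uniq => /andP[].
have vA := branchA bv.
have inAK w : (w \in A :\: K) = (w \notin sK) && (w \in A).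
  by rewrite in_setD [w \in K]inE.
have cross w w' : w \in sK -> w' \in A -> w' \notin sK -> e w w' -> w = u /\ w' = v.
  move=> wK w'A w'K eww'; have w'w : w' \in nbh A e w by rewrite in_nbh w'A.
  have inN (N : {set T}) : nbh A e w = N -> w' \in N by move=> <-.
  move: w'K; rewrite !inE !negb_or => /and5P[/negPf w'u /negPf w'x /negPf w'y /negPf w'z /negPf w's].
  move: wK; rewrite !inE => /or4P[/eqP wu|/eqP wx|/eqP wy|/orP[/eqP wz|/eqP ws]].
  - split=> //; apply/eqP; rewrite wu in inN.
    by move: (inN _ nu); rewrite !inE w'x w's.
  - by rewrite wx in inN; move: (inN _ nx); rewrite !inE w'u w'y.
  - by rewrite wy in inN; move: (inN _ ny); rewrite !inE w'x w'z.
  - by rewrite wz in inN; move: (inN _ nz); rewrite !inE w'y w's.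
  - by rewrite ws in inN; move: (inN _ ns); rewrite !inE w'z w'u.
have bu : branch A e t u.
  rewrite /branch uA /tdeg nu (tK u) ?inE ?eqxx // /no_token addn0.
  by rewrite card_set3 //; apply: (mask_uniq us [:: false; true; false; false; true; true]).
have out w w' : w \in A :\: K -> w != v -> w' \in nbh A e w -> w' \in A :\: K.
  rewrite !inAK => /andP[wK wA] wv /nbhP[w'A eww']; rewrite w'A andbT.
  apply: contraNN wv => w'K; rewrite e_sym in eww'.
  by have [_ ->] := cross w' w w'K wA wK eww'.
have nbhE w : w \in A :\: K -> w != v -> nbh (A :\: K) e w = nbh A e w.
  move=> wAK wv; apply/setP => w'; apply/idP/idP => [|w'w].
    by rewrite !in_nbh inAK => /andP[/andP[_ ->]].
  by rewrite in_nbh (out w) //; case/nbhP: w'w.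
have nbhv : nbh (A :\: K) e v = nbh A e v :\ u.
  apply/setP => w; rewrite in_setD1 !in_nbh inAK.
  have [wA|] := boolP (w \in A); last by rewrite !andbF.
  rewrite !andbT /=; have [evw|] := boolP (e v w); last by rewrite !andbF.
  rewrite !andbT; apply/idP/idP; first by apply: contraNN => /eqP->; rewrite !inE eqxx.
  apply: contraNN => wK; rewrite e_sym in evw.
  by have [-> _] := cross w v wK vA vK evw.
have tdegE w : w \in A :\: K -> tdeg (A :\: K) e t' w = tdeg A e t w.
  move=> wAK; rewrite /tdeg /t'; have [->|wv] := eqVneq w v.
    rewrite nbhv (cardsD1 u (nbh A e v)) in_nbh uA e_sym.
    have /nbhP[_ ->] : v \in nbh A e u by rewrite nu !inE eqxx orbT.
    by rewrite /= addnA addn1 add1n addSn.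
  by rewrite nbhE // addn0.
have branchE w : branch (A :\: K) e t' w = (w \notin sK) && branch A e t w.
  rewrite /branch inAK; case wK: (w \notin sK) => //=.
  by case wA: (w \in A) => //=; rewrite tdegE // inAK wK.
have bvn w : ~~ branch A e t w -> w != v by apply: contraNneq => ->.
have innerE w : inner (A :\: K) e t' w = (w \notin sK) && inner A e t w.
  rewrite /inner inAK branchE; case wK: (w \notin sK) => //=.
  case wA: (w \in A) => //=; have [_|nbw] := boolP (branch A e t w) => //=.
  have wAK : w \in A :\: K by rewrite inAK wK.
  rewrite nbhE ?bvn //; apply: eq_forallb_in => w' w'w.
  have := out w w' wAK (bvn w nbw) w'w; rewrite inAK => /andP[w'K _].
  by rewrite branchE w'K.
split.
- by move=> w wAK; rewrite tdegE // deg2 //; move: wAK; rewrite inAK => /andP[].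
- move=> w wAK; rewrite tdegE // /t'; have [-> _|wv] := eqVneq w v.
    by case/andP: bv.
  by rewrite addn0; apply: tokb; move: wAK; rewrite inAK => /andP[].
- have keep p q : p \notin sK -> q \notin sK -> c5_root A e t p q ->
      c5_root (A :\: K) e t' p q.
    move=> pK qK [x1 [y1 [z1 [s1 [[us1 pA tK1] [np nx1 ny1 nz1 ns1]]]]]].
    have nonb w p' q' : nbh A e w = [set p'; q'] ->
        w \in [:: p; x1; y1; z1; s1] -> ~~ branch A e t w.
      move=> nw wK1; rewrite /branch /tdeg nw (tK1 w wK1) addn0 cards2.
      by case: (w \in A) => //; case: (p' != q').
    have pAK : p \in A :\: K by rewrite inAK pK.
    have nbx := nonb x1 _ _ nx1; have nby := nonb y1 _ _ ny1.
    have nbz := nonb z1 _ _ nz1; have nbs := nonb s1 _ _ ns1.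
    rewrite !inE !eqxx !orbT in nbx nby nbz nbs.
    (* If [p] were [v], its neighbour [u] would be a vertex of degree 2 on the second cycle, though
       it is a branch vertex, or it would be [q], which is outside [sK]. *)
    have pv : p != v.
      apply/eqP => pv; have : u \in nbh A e p.
        have /nbhP[_ euv] : v \in nbh A e u by rewrite nu !inE eqxx orbT.
        by rewrite pv in_nbh uA e_sym.
      rewrite np !inE => /orP[/orP[]|] /eqP uE.
      - by move: (nbx isT); rewrite -uE bu.
      - by move: (nbs isT); rewrite -uE bu.
      - by move: qK; rewrite -uE !inE eqxx.
    have xAK : x1 \in A :\: K by apply: (out p) => //; rewrite np !inE eqxx.
    have sAK : s1 \in A :\: K by apply: (out p) => //; rewrite np !inE eqxx orbT.
    have yAK : y1 \in A :\: K.
      by apply: (out x1) => //; rewrite ?bvn ?nbx // nx1 !inE eqxx orbT.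
    have zAK : z1 \in A :\: K.
      by apply: (out s1) => //; rewrite ?bvn ?nbs // ns1 !inE eqxx.
    exists x1, y1, z1, s1; split; split=> //.
    + move=> w wK1; rewrite /t' (tK1 w wK1) /no_token add0n.
      suff /negPf-> : w != v by [].
      by move: wK1; rewrite !inE => /or4P[|||/orP[]] /eqP->; rewrite ?pv ?bvn ?nbx ?nby ?nbz ?nbs.
    + by rewrite nbhE.
    + by rewrite nbhE ?bvn ?nbx.
    + by rewrite nbhE ?bvn ?nby.
    + by rewrite nbhE ?bvn ?nbz.
    + by rewrite nbhE ?bvn ?nbs.
  move=> p q; rewrite !branchE => /andP[pK bp] /andP[qK bq] epq.
  by case: (adj p q bp bq epq) => h; [left | right]; apply: keep.
move=> w; rewrite innerE => /andP[wK iw].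
have [b [bb [p [q [r [[pA qA pq] [ewp epb ebq eqr ir]]]]] uniqb]] := hub w iw.
have noin a a' : a \in A -> a' \in A -> a \notin sK -> e a a' -> inner A e t a' -> a' \notin sK.
  move=> aA a'A aK eaa' /and3P[_ nba _]; apply: contraNN nba => a'K.
  by rewrite e_sym in eaa'; have [-> _] := cross a' a a'K aA aK eaa'.
have [nbp wA nbw] : [/\ ~~ branch A e t p, w \in A & ~~ branch A e t w].
  by case/and3P: iw => wA nbw /forall_inP h; split=> //; apply: h; rewrite in_nbh pA.
have rA : r \in A by case/and3P: ir.
have nbq : ~~ branch A e t q.
  by case/and3P: ir => _ _ /forall_inP; apply; rewrite in_nbh qA e_sym.
have pK : p \notin sK.
  apply: contraNN nbw => pK; rewrite e_sym in ewp.
  by have [_ ->] := cross p w pK wA wK ewp.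
have bA := branchA bb.
have bK : b \notin sK.
  apply: contraNN nbp => bK; rewrite e_sym in epb.
  by have [_ ->] := cross b p bK pA pK epb.
have qK : q \notin sK.
  apply: contraNN nbq => qK; rewrite e_sym in ebq.
  by have [-> _] := cross q b qK bA bK ebq.
have rK := noin q r qA rA qK eqr ir.
exists b; split; first by rewrite branchE bK.
  exists p, q, r; split; first by split=> //; rewrite inAK ?pK ?qK.
  by split=> //; rewrite innerE rK.
move=> x1 v1; rewrite inAK branchE => /andP[_ x1A] ewx1 ex1v1 /andP[_ bv1].
exact: (uniqb x1).
Qed.

Lemma reduced_solvable A e t : symmetric e -> reduced A e t -> solvable A e t.
Proof.
move=> e_sym; have [n] := ubnP #|A|; elim: n A t => // n IHn A t ltAn redA.
have [/existsP[u /existsP[v /and3P[bu bv euv]]]|indep] :=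
  boolP [exists u, exists v, [&& branch A e t u, branch A e t v & e u v]].
  have [_ _ adj _] := redA.
  have strip u' v' : branch A e t v' -> c5_root A e t u' v' -> solvable A e t.
    move=> bv' [x [y [z [s cyc]]]]; apply: (strip_solvable e_sym cyc).
    apply: IHn; last exact: strip_reduced redA.
    rewrite -ltnS; apply: leq_trans ltAn; rewrite ltnS; apply: proper_card.
    have [[_ uA _] _] := cyc.
    apply/properP; split; first exact: subsetDl.
    by exists u' => //; rewrite !inE eqxx.
  by case: (adj u v bu bv euv); apply: strip.
have [deg2 tokb adj hub] := redA.
apply: (independent_solvable e_sym deg2 tokb _ hub) => u v bu bv.
apply: contraNN indep => euv; apply/existsP; exists u; apply/existsP; exists v.
by rewrite bu bv.
Qed.

End Strip.

(** * Bypassing three consecutive vertices of degree 2 *)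

Section Subdivision.

Variable T : finType.
Implicit Types (A K : {set T}) (e : rel T) (a b p u v w x y : T) (L : T -> label).

Definition add_edge a b e : rel T :=
  fun x y => [|| e x y, (x == a) && (y == b) | (x == b) && (y == a)].

(** Of the neighbours that [a] had in the bypassed graph only [b] is lost, and [p] takes over: it
    shows the colours of [b] if [a] has none, and value 2 if [b] has 2 and [a] has 0. *)
Lemma reroute_at A K e a b p L L' : a != b -> p \in A -> e a p ->
  (forall w, w \notin K -> L' w = L w) -> a \notin K -> 
  (~~ (has1 (L a) || has2 (L a)) ->
     (has1 (L b) ==> has1 (L' p)) && (has2 (L b) ==> has2 (L' p))) ->
  (roman (L a) = 0 -> roman (L b) = 2 -> roman (L' p) = 2) ->
  rainbow_at (A :\: K) (add_edge a b e) L a ->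
  roman_at (A :\: K) (add_edge a b e) no_token L a ->
  rainbow_at A e L' a /\ roman_at A e no_token L' a.
Proof.
move=> ab pA eap L'E aK colb romb.
have via (P : pred label) : (P (L b) -> P (L' p)) ->
    [exists v in nbh (A :\: K) (add_edge a b e) a, P (L v)] ->
    [exists v in nbh A e a, P (L' v)].
  move=> Pbp /exists_inP[v]; rewrite in_nbh => /andP[/setDP[vA vK]].
  case/or3P=> [eav|/andP[_ /eqP->]|/andP[/eqP ab' _]] Pv.
  - by apply/exists_inP; exists v; rewrite ?in_nbh ?vA ?L'E.
  - by apply/exists_inP; exists p; rewrite ?in_nbh ?pA ?Pbp.
  - by rewrite ab' eqxx in ab.
rewrite /rainbow_at /roman_at => h h0; rewrite !L'E //; split.
  have [na|na] := boolP (has1 (L a) || has2 (L a)).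
    by rewrite orbA na.
  have /andP[/implyP c1 /implyP c2] := colb na.
  by move: h; rewrite !orbA (negPf na) /= => /andP[/(via _ c1)-> /(via _ c2)->].
case E: (roman (L a)) => [|k] //=; move: h0; rewrite E /=.
by apply: (via (fun c => roman c == 2)) => /eqP hb; rewrite romb.
Qed.

(** Weight 2 + 2 on three vertices, exactly their budget. If only one end is coloured, the empty end
    may have relied on it over the new edge: its colours are copied to the path vertex next to the
    empty end, and their complement goes next to the coloured end. In the other cases neither end
    gained a colour it relied on, and the middle vertex takes both. The Roman values follow the same
    pattern. *)
Definition path_label (ca cb : label) : seq label :=
  let na := has1 ca || has2 ca in let nb := has1 cb || has2 cb in
  let: (p, y, r) :=
    if na && ~~ nb then
      ((~~ has1 ca, ~~ has2 ca), (false, false), (has1 ca, has2 ca))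
    else if ~~ na && nb then
      ((has1 cb, has2 cb), (false, false), (~~ has1 cb, ~~ has2 cb))
    else ((false, false), (true, true), (false, false)) in
  let: (gp, gy, gr) :=
    if (roman ca == 2) && (roman cb == 0) then (0, 0, 2)
    else if (roman cb == 2) && (roman ca == 0) then (2, 0, 0)
    else (0, 2, 0) in
  [:: (p, gp); (y, gy); (r, gr)].

Lemma path_labelP ca cb (l := path_label ca cb) (p := nth (false, false, 0) l 0)
    (y := nth (false, false, 0) l 1) (r := nth (false, false, 0) l 2) :
  [/\ ~~ (has1 ca || has2 ca) -> (has1 cb ==> has1 p) && (has2 cb ==> has2 p),
      ~~ (has1 cb || has2 cb) -> (has1 ca ==> has1 r) && (has2 ca ==> has2 r),
      [|| has1 p, has2 p | (has1 ca || has1 y) && (has2 ca || has2 y)],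
      [|| has1 y, has2 y | (has1 p || has1 r) && (has2 p || has2 r)] &
      [|| has1 r, has2 r | (has1 y || has1 cb) && (has2 y || has2 cb)]] /\
  [/\ roman ca = 0 -> roman cb = 2 -> roman p = 2,
      roman cb = 0 -> roman ca = 2 -> roman r = 2,
      [|| 0 < roman p, roman ca == 2 | roman y == 2],
      [|| 0 < roman y, roman p == 2 | roman r == 2] &
      [|| 0 < roman r, roman y == 2 | roman cb == 2]].
Proof.
rewrite /p /y /r /l /path_label {p y r l}.
case: ca => [[a1 a2] ga]; case: cb => [[b1 b2] gb]; rewrite /has1 /has2 /roman /=.
split.
  case: (if (ga == 2) && _ then _ else _) => [[gp gy] gr].
  by case: a1; case: a2; case: b1; case: b2.
case: (if (a1 || a2) && _ then _ else _) => [[p y] r].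
by case: ga => [|[|[|ga]]]; case: gb => [|[|[|gb]]].
Qed.

Lemma path_label_cost ca cb : \sum_(c <- path_label ca cb) 3 * weight c = 12.
Proof.
rewrite /path_label /weight.
case: ca => [[a1 a2] ga]; case: cb => [[b1 b2] gb]; rewrite /has1 /has2 /roman /=.
case: a1; case: a2; case: b1; case: b2 => /=;
  by case: ifP => _; [|case: ifP => _]; rewrite !big_cons big_nil.
Qed.

Lemma subdivide_solvable A e a p y r b : symmetric e ->
  uniq [:: a; p; y; r; b] -> {subset [:: a; p; y; r; b] <= A} ->
  e a p -> e p y -> e y r -> e r b ->
  solvable (A :\: [set w in [:: p; y; r]]) (add_edge a b e) no_token ->
  solvable A e no_token.
Proof.
move=> e_sym us sA eap epy eyr erb; set s := [:: p; y; r]; set K := [set w in s].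
case=> L domL costL; pose l := path_label (L a) (L b); pose L' := relabel s l L.
have [aA pA yA rA bA] : [/\ a \in A, p \in A, y \in A, r \in A & b \in A].
  by split; apply: sA; rewrite !inE eqxx ?orbT.
have uss : uniq s by apply: (mask_uniq us [:: false; true; true; true]).
have aK : a \notin s by move: us => /andP[]; rewrite !inE !negb_or => /and4P[-> -> ->].
have bK : b \notin s.
  move: us; rewrite -[[:: a; p; y; r; b]]/(rcons (a :: s) b) rcons_uniq.
  by rewrite inE negb_or => /andP[/andP[]].
have ab : a != b.
  by move: us => /andP[]; rewrite !inE !negb_or => /and4P[].
have inK w : (w \in K) = (w \in s) by rewrite inE.
have L'E w : w \notin K -> L' w = L w by rewrite inK; apply: relabel_out.
have szl : size l = size s.
  rewrite /l /path_label; case: (if _ && ~~ _ then _ else _) => [[? ?] ?].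
  by case: (if _ && _ then _ else _) => [[? ?] ?].
have L'p : L' p = nth (false, false, 0) l 0 by apply: (relabel_nth L p uss szl (i := 0)).
have L'y : L' y = nth (false, false, 0) l 1 by apply: (relabel_nth L p uss szl (i := 1)).
have L'r : L' r = nth (false, false, 0) l 2 by apply: (relabel_nth L p uss szl (i := 2)).
have L'a : L' a = L a by rewrite L'E // inK.
have L'b : L' b = L b by rewrite L'E // inK.
exists L'; last first.
  have sKs : K \subset A.
    by apply/subsetP => w; rewrite inK !inE => /or3P[]/eqP->.
  have sumK (F : T -> nat) :
      \sum_(w in A) F w = \sum_(w in K) F w + \sum_(w in A :\: K) F w.
    by rewrite (big_setID K) (setIidPr sKs).
  rewrite /affordable !sumK; apply: leq_add.
    rewrite (sum_relabel (F := fun v c => 3 * weight c + no_token v)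
             (G := fun c => 3 * weight c)) => // [|w _ c]; last by rewrite addn0.
    rewrite [leqRHS](eq_bigr (fun=> 4)) => [|v _]; last by rewrite /no_token muln0 mul0n addn0.
    rewrite sum_nat_const cardsE (card_uniqP uss) /l.
    by rewrite path_label_cost.
  rewrite (eq_bigr (fun v => 3 * weight (L v) + no_token v)); last first.
    by move=> w /setDP[_ /L'E ->].
  rewrite [leqRHS](eq_bigr (fun v => 4 + 3 * no_token v * (roman (L v) == 2))) //.
move=> w wA.
have ex (P : pred label) u v : v \in A -> e u v -> P (L' v) ->
    [exists v in nbh A e u, P (L' v)].
  by move=> vA euv Pv; apply/exists_inP; exists v; rewrite ?in_nbh ?vA.
have [[c1 c2 c3 c4 c5] [r1 r2 r3 r4 r5]] := path_labelP (L a) (L b).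
rewrite -/l -L'p -L'y -L'r -L'a -L'b in c1 c2 c3 c4 c5 r1 r2 r3 r4 r5.
have or_ex (P : pred label) u v v' : v \in A -> v' \in A -> e u v -> e u v' ->
    P (L' v) || P (L' v') -> [exists v in nbh A e u, P (L' v)].
  by move=> vA v'A euv euv' /orP[]; apply: ex.
have between u v v' : u \in A -> v \in A -> v' \in A -> e u v -> e u v' ->
    [|| has1 (L' u), has2 (L' u) |
        (has1 (L' v) || has1 (L' v')) && (has2 (L' v) || has2 (L' v'))] ->
    [|| 0 < roman (L' u), roman (L' v) == 2 | roman (L' v') == 2] ->
    rainbow_at A e L' u /\ roman_at A e no_token L' u.
  move=> uA vA v'A euv euv' rb ro; split.
    rewrite /rainbow_at; case/or3P: rb => [->|->|/andP[h1 h2]]; rewrite ?orbT //.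
    by rewrite (or_ex has1 u v v') ?(or_ex has2 u v v') ?orbT.
  rewrite /roman_at; case/orP: ro => [->|h] //.
  by rewrite (or_ex (fun c => roman c == 2) u v v') ?orbT.
have [wK|wK] := boolP (w \in K).
  move: wK; rewrite inK !inE => /or3P[]/eqP->.
  - by apply: (between p a y); rewrite // e_sym.
  - by apply: (between y p r); rewrite // e_sym.
  - by apply: (between r y b); rewrite // e_sym.
have [rb ro] := domL w (etrans (in_setD _ _ _) (introT andP (conj wK wA))).
have [wa|wa] := eqVneq w a.
  subst w; rewrite L'a L'b in c1 r1.
  by apply: (reroute_at (K := K) (b := b) (p := p) (L := L)).
have [wb|wb] := eqVneq w b.
  subst w; rewrite L'a L'b in c2 r2.
  have eN : nbh (A :\: K) (add_edge b a e) b = nbh (A :\: K) (add_edge a b e) b.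
    by apply/setP => v; rewrite !in_nbh /add_edge; congr (_ && (_ || _)); apply: orbC.
  rewrite /rainbow_at /roman_at -eN in rb ro.
  by apply: (reroute_at (K := K) (b := a) (p := r) (L := L)); rewrite 1?eq_sym // e_sym.
have sN : nbh (A :\: K) (add_edge a b e) w \subset nbh A e w.
  apply/subsetP => v; rewrite !in_nbh => /andP[/setDP[-> _]] /=.
  by rewrite /add_edge (negPf wa) (negPf wb) /= orbF.
have eqL : {in nbh (A :\: K) (add_edge a b e) w, L' =1 L}.
  by move=> v /nbhP[/setDP[_ /L'E]].
by split; [apply: rainbow_atS rb | apply: roman_atS ro] => //; apply: L'E.
Qed.

End Subdivision.

(** * Components that are a [C_5] *)

Section FiveCycles.

Variable T : finType.
Implicit Types (A K : {set T}) (e : rel T) (u v w x y : T).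

Definition c5_at A e x1 x2 x3 x4 x5 : bool :=
  [&& uniq [:: x1; x2; x3; x4; x5], nbh A e x1 == [set x5; x2],
      nbh A e x2 == [set x1; x3], nbh A e x3 == [set x2; x4],
      nbh A e x4 == [set x3; x5] & nbh A e x5 == [set x4; x1]].

Definition c5_through A e x1 : bool :=
  [exists x2, exists x3, exists x4, exists x5, c5_at A e x1 x2 x3 x4 x5].

(** Deletions destroy connectedness, so the induction runs over possibly disconnected graphs and
    excludes [C_5] as a component. *)
Definition good_graph A e : Prop :=
  (forall v, v \in A -> 1 < #|nbh A e v|) /\ forall v, ~~ c5_through A e v.

Lemma c5_throughP A e x1 :
  reflect (exists x2 x3 x4 x5, c5_at A e x1 x2 x3 x4 x5) (c5_through A e x1).
Proof.
apply: (iffP existsP) => [[x2 /existsP[x3 /existsP[x4 /existsP[x5 h]]]]|].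
  by exists x2, x3, x4, x5.
by case=> x2 [x3 [x4 [x5 h]]]; exists x2; apply/existsP; exists x3;
  apply/existsP; exists x4; apply/existsP; exists x5.
Qed.

Lemma c5_rot A e x1 x2 x3 x4 x5 :
  c5_at A e x1 x2 x3 x4 x5 -> c5_at A e x2 x3 x4 x5 x1.
Proof.
case/and5P=> us n1 n2 n3 /andP[n4 n5]; apply/and5P; split=> //; last by rewrite n5.
by rewrite -(rot_uniq 4).
Qed.

Lemma c5_rev A e x1 x2 x3 x4 x5 :
  c5_at A e x1 x2 x3 x4 x5 -> c5_at A e x1 x5 x4 x3 x2.
Proof.
case/and5P=> us n1 n2 n3 /andP[n4 n5].
rewrite /c5_at setUC n1 setUC n5 setUC n4 setUC n3 setUC n2 !andbT.
by rewrite -(rot_uniq 1) -rev_uniq.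
Qed.

Lemma c5_mem A e x1 x2 x3 x4 x5 w : c5_at A e x1 x2 x3 x4 x5 ->
  w \in [:: x1; x2; x3; x4; x5] -> c5_through A e w.
Proof.
move=> c1; have c2 := c5_rot c1; have c3 := c5_rot c2; have c4 := c5_rot c3.
have c5 := c5_rot c4.
rewrite !inE => /or4P[|||/orP[]] /eqP->; apply/c5_throughP.
- by exists x2, x3, x4, x5.
- by exists x3, x4, x5, x1.
- by exists x4, x5, x1, x2.
- by exists x5, x1, x2, x3.
- by exists x1, x2, x3, x4.
Qed.

Lemma c5_edges A e x1 x2 x3 x4 x5 : c5_at A e x1 x2 x3 x4 x5 ->
  {subset [:: x1; x2; x3; x4; x5] <= A} /\
  [&& e x1 x2, e x2 x3, e x3 x4, e x4 x5 & e x5 x1].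
Proof.
case/and5P=> us /eqP n1 /eqP n2 /eqP n3 /andP[/eqP n4 /eqP n5].
have /nbhP[x2A e12] : x2 \in nbh A e x1 by rewrite n1 !inE eqxx orbT.
have /nbhP[x3A e23] : x3 \in nbh A e x2 by rewrite n2 !inE eqxx orbT.
have /nbhP[x4A e34] : x4 \in nbh A e x3 by rewrite n3 !inE eqxx orbT.
have /nbhP[x5A e45] : x5 \in nbh A e x4 by rewrite n4 !inE eqxx orbT.
have /nbhP[x1A e51] : x1 \in nbh A e x5 by rewrite n5 !inE eqxx orbT.
split; last by rewrite e12 e23 e34 e45 e51.
by apply/allP; rewrite /= x1A x2A x3A x4A x5A.
Qed.

Lemma c5_closed A e x1 x2 x3 x4 x5 w v : c5_at A e x1 x2 x3 x4 x5 ->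
  w \in [:: x1; x2; x3; x4; x5] -> v \in nbh A e w ->
  v \in [:: x1; x2; x3; x4; x5].
Proof.
case/and5P=> us /eqP n1 /eqP n2 /eqP n3 /andP[/eqP n4 /eqP n5].
by rewrite !in_cons in_nil orbF => /or4P[|||/orP[]] /eqP->;
  rewrite ?n1 ?n2 ?n3 ?n4 ?n5 => /set2P[]->; rewrite eqxx ?orbT.
Qed.

Lemma c5_eq A A' e e' x1 x2 x3 x4 x5 :
  {in [:: x1; x2; x3; x4; x5], nbh A' e' =1 nbh A e} ->
  c5_at A e x1 x2 x3 x4 x5 -> c5_at A' e' x1 x2 x3 x4 x5.
Proof. by move=> eqN; rewrite /c5_at !eqN // !inE eqxx ?orbT. Qed.

End FiveCycles.

(** Serves to extract solvability from a case analysis at each vertex; the finite enumeration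
    replaces excluded middle for [S]. *)
Lemma finite_alternative (T : finType) (S : Prop) (P : T -> Prop) :
  (forall x, S \/ P x) -> S \/ forall x, P x.
Proof.
move=> h; suff [|all] : S \/ {in enum T, forall x, P x}; first by left.
  by right=> x; apply: all; rewrite mem_enum.
elim: (enum T) => [|x s [|IHs]]; [by right | by left |].
have [|Px] := h x; first by left.
by right=> y; rewrite inE => /predU1P[->|/IHs].
Qed.

(** * The structure of a minimal counterexample *)

Section Minimal.

Variables (T : finType) (A : {set T}) (e : rel T).
Hypothesis e_sym : symmetric e.
Hypothesis e_irr : irreflexive e.
Hypothesis goodA : good_graph A e.

Definition arcs (B : {set T}) (d : rel T) : {set T * T} :=
  [set p | [&& p.1 \in B, p.2 \in B & d p.1 p.2]].

Hypothesis smaller : forall (A' : {set T}) (e' : rel T),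
  symmetric e' -> irreflexive e' -> good_graph A' e' ->
  (#|A'| < #|A|) || (A' == A) && (#|arcs A' e'| < #|arcs A e|) ->
  solvable A' e' no_token.

Implicit Types (u v w x y z : T).

Notation nb := (nbh A e).
Notation sol := (solvable A e no_token).

Lemma deg_ge2 v : v \in A -> 1 < #|nb v|. Proof. by case: goodA => h _; apply: h. Qed.

Lemma noC5 x1 x2 x3 x4 x5 : ~~ c5_at A e x1 x2 x3 x4 x5.
Proof.
have [_ /(_ x1)] := goodA; apply: contraNN => h; apply/c5_throughP.
by exists x2, x3, x4, x5.
Qed.

(** Vertices outside a union of components keep their neighbourhoods, so the rest is a smaller good
    graph, while [l] settles the removed part. *)
Lemma remove_component s l E v0 : uniq s -> {subset s <= A} -> 0 < size s ->
  all (fun w => nb w \subset [set x in s]) s ->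
  size l = size s ->
  all (fun ij => [&& ij.1 < size s, ij.2 < size s &
                    e (nth v0 s ij.1) (nth v0 s ij.2)]) E ->
  all (fun i => rainbow_check l E i && roman_check l E i) (iota 0 (size s)) ->
  3 * sumn (map weight l) <= 4 * size s ->
  sol.
Proof.
move=> us sA s0 /allP closed szl eE chk cost.
have sKA : [set x in s] \subset A by apply/subsetP => x; rewrite inE; apply: sA.
apply: (solvable_glue sKA); first exact: (solvable_list e_sym us szl eE).
have nbE w : w \in A :\: [set x in s] -> nbh (A :\: [set x in s]) e w = nb w.
  rewrite inE [w \in [set _ in _]]inE => /andP[ws wA].
  apply/setP => x; rewrite !in_nbh in_setD [x \in [set _ in _]]inE.
  have [xs|_] //= := boolP (x \in s).
  have [ewx|] := boolP (e w x); last by rewrite andbF.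
  have : w \in nb x by rewrite in_nbh wA e_sym.
  by move/(subsetP (closed x xs)); rewrite inE (negPf ws).
apply: smaller; [by [] | by [] | split=> [v vA|v] | apply/orP; left].
- by rewrite nbE // deg_ge2 //; case/setDP: vA.
- apply/negP => /c5_throughP[x2 [x3 [x4 [x5 c]]]].
  have [inA _] := c5_edges c.
  move/negP: (noC5 v x2 x3 x4 x5); apply; apply: c5_eq c => w /inA wA.
  by rewrite nbE.
- apply: proper_card; apply/properP; split; first exact: subsetDl.
  case: s s0 sA {us closed szl eE chk sKA nbE cost} => // x s _ sA.
  by exists x; rewrite ?sA // !inE eqxx.
Qed.

Definition del_edge u v : rel T :=
  fun x y => e x y && ~~ ((x == u) && (y == v) || (x == v) && (y == u)).

Lemma del_edge_sym u v : symmetric (del_edge u v).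
Proof. by move=> x y; rewrite /del_edge e_sym orbC; congr (_ && ~~ (_ || _)); apply: andbC. Qed.

Lemma del_edgeC u v : del_edge v u =2 del_edge u v.
Proof. by move=> x y; rewrite /del_edge orbC. Qed.

Lemma nbh_del_other u v w : w != u -> w != v -> nbh A (del_edge u v) w = nb w.
Proof.
move=> /negPf wu /negPf wv; apply/setP => x.
by rewrite !in_nbh /del_edge wu wv /= andbT.
Qed.

Lemma nbh_del_end u v : u != v -> nbh A (del_edge u v) u = nb u :\ v.
Proof.
move=> uv; apply/setP => x; rewrite in_setD1 !in_nbh /del_edge eqxx (negPf uv) /=.
by rewrite orbF andbA andbC.
Qed.

(** If [v] is on the new cycle, it is not next to [u] there, and the component was a [C_5] with a
    chord. Otherwise the edge is the bridge to a pendant [C_5]. *)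
Lemma deleted_c5 u v : u \in A -> v \in A -> e u v ->
  c5_through A (del_edge u v) u -> sol \/ c5_root A e no_token u v.
Proof.
move=> uA vA euv /c5_throughP[x2 [x3 [x4 [x5 c]]]].
have uv : u != v by apply: contraTneq euv => ->; rewrite e_irr.
have [_ /and5P[e12 e23 e34 e45 e51]] := c5_edges c.
have del_e p q : del_edge u v p q -> e p q by case/andP.
have evn p : del_edge u v u p -> p != v.
  by move=> h; apply: contraTneq h => ->; rewrite /del_edge !eqxx andbF.
have [/and5P[us _ _ _ _] _] := (c, tt).
have nu x y : nbh A (del_edge u v) u = [set x; y] -> nb u = [set x; y; v].
  move=> h; apply/setP => w; rewrite !inE.
  have := congr1 (fun X : {set T} => w \in X) h.
  rewrite nbh_del_end // !inE; have [->|_] /= := eqVneq w v.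
    by rewrite vA euv orbT.
  by rewrite orbF.
(* With the chord, value 2 on [u] reaches three vertices, so 3 + 3 suffices: 18 units out of 20. *)
have house y2 y3 y4 y5 : c5_at A (del_edge u v) u y2 y3 y4 y5 -> v = y3 -> sol.
  move=> c' v3; have [inA /and5P[f1 f2 f3 f4 f5]] := c5_edges c'.
  case/and5P: c' => us' /eqP n1 /eqP n2 /eqP n3 /andP[/eqP n4 /eqP n5].
  have nv : nb v = [set y2; y4; u].
    apply/setP => w; rewrite !inE.
    have := congr1 (fun X : {set T} => w \in X) n3.
    rewrite -v3 !inE /del_edge eqxx (eq_sym v) (negPf uv) /=.
    have [->|_] := eqVneq w u; first by rewrite uA e_sym euv orbT.
    by rewrite !andbT orbF.
  pose E := [:: (0, 1); (1, 2); (2, 3); (3, 4); (4, 0); (0, 2)].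
  pose l : seq label := [:: (true, false, 2); (false, false, 0); (false, true, 0);
                            (false, false, 1); (true, false, 0)].
  apply: (@remove_component [:: u; y2; y3; y4; y5] l E u) => //.
  - have ne w : w \in [:: y2; y4; y5] -> nb w = nbh A (del_edge u v) w.
      move=> h; rewrite nbh_del_other //.
        move: us'; rewrite /= !inE !negb_or in h *.
        case/andP=> /and4P[u2 u3 u4 u5] _.
        by case/or3P: h => /eqP->; rewrite eq_sym.
      move: us'; rewrite v3 /= !inE !negb_or in h *.
      case/and5P=> _ /and3P[u23 _ _] /andP[u34 u35] _ _.
      by case/or3P: h => /eqP->; rewrite // eq_sym.
    apply/allP => w; rewrite !inE => /or4P[|||/orP[]] /eqP->.
    + by rewrite (nu _ _ n1) v3; apply/subsetP => z; rewrite !inE -!orbA =>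
        /or3P[]/eqP->; rewrite eqxx ?orbT.
    + by rewrite ne ?n2 ?inE ?eqxx //; apply/subsetP => z; rewrite !inE =>
        /orP[]/eqP->; rewrite eqxx ?orbT.
    + by rewrite -v3 nv v3; apply/subsetP => z; rewrite !inE -!orbA =>
        /or3P[]/eqP->; rewrite eqxx ?orbT.
    + by rewrite ne ?n4 ?inE ?eqxx ?orbT //; apply/subsetP => z; rewrite !inE =>
        /orP[]/eqP->; rewrite eqxx ?orbT.
    + by rewrite ne ?n5 ?inE ?eqxx ?orbT //; apply/subsetP => z; rewrite !inE =>
        /orP[]/eqP->; rewrite eqxx ?orbT.
  - rewrite /= (del_e _ _ f1) (del_e _ _ f2) (del_e _ _ f3) (del_e _ _ f4).
    by rewrite (del_e _ _ f5) -v3 euv.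
have [v3|v3] := eqVneq v x3; first by left; apply: house c _.
have [v4|v4] := eqVneq v x4; first by left; apply: house (c5_rev c) _.
right; exists x2, x3, x4, x5.
case/and5P: c => _ /eqP n1 /eqP n2 /eqP n3 /andP[/eqP n4 /eqP n5].
have v2 : v != x2 by rewrite eq_sym evn.
have v5 : v != x5 by rewrite eq_sym evn // del_edge_sym.
have ne w : w \in [:: x2; x3; x4; x5] -> nb w = nbh A (del_edge u v) w.
  move=> h; rewrite nbh_del_other //.
    by have /andP[u_out _] := us; apply: contraNneq u_out => <-.
  apply: contraTneq h => ->; rewrite !inE !negb_or.
  by rewrite v2 v3 v4 v5.
split; split=> //.
- rewrite -[_ :: _]/(rcons [:: u; x2; x3; x4; x5] v) rcons_uniq us andbT.
  by rewrite !inE !negb_or eq_sym uv v2 v3 v4 v5.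
- by rewrite (nu _ _ n1) (setUC [set x5]).
- by rewrite ne ?n2 // !inE eqxx.
- by rewrite ne ?n3 // !inE eqxx ?orbT.
- by rewrite ne ?n4 // !inE eqxx ?orbT.
- by rewrite ne ?n5 // !inE eqxx ?orbT.
Qed.

(** Both ends keep degree at least 2 after the deletion, so it can fail only by creating a [C_5]
    component; this contains [u] or [v], the only vertices whose neighbourhoods change. *)
Lemma adjacent_branches u v :
  branch A e no_token u -> branch A e no_token v -> e u v ->
  sol \/ (c5_root A e no_token u v \/ c5_root A e no_token v u).
Proof.
rewrite /branch /tdeg !addn0 => /andP[uA du] /andP[vA dv] euv.
have uv : u != v by apply: contraTneq euv => ->; rewrite e_irr.
have [uthrough|nu] := boolP (c5_through A (del_edge u v) u).
  by case: (deleted_c5 uA vA euv uthrough); [left | right; left].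
have nbC w : nbh A (del_edge v u) w = nbh A (del_edge u v) w.
  by apply/setP => x; rewrite !in_nbh del_edgeC.
have [vthrough|nv] := boolP (c5_through A (del_edge u v) v).
  suff vt : c5_through A (del_edge v u) v.
    by rewrite e_sym in euv; case: (deleted_c5 vA uA euv vt); [left | right; right].
  case/c5_throughP: vthrough => x2 [x3 [x4 [x5 c]]]; apply/c5_throughP.
  by exists x2, x3, x4, x5; apply: c5_eq c => w _.
left; apply: (@solvable_subrel _ A (del_edge u v)) => [x y /andP[]//|].
apply: smaller; first exact: del_edge_sym.
- by move=> x; rewrite /del_edge e_irr.
- split=> [w wA|w].
    have [->|wu] := eqVneq w u.
      by rewrite nbh_del_end //; have := cardsD1 v (nb u); move: du; clear; lia.
    have [->|wv] := eqVneq w v; last by rewrite nbh_del_other // deg_ge2.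
    by rewrite -nbC nbh_del_end 1?eq_sym //; have := cardsD1 u (nb v); move: dv; clear; lia.
  apply/negP => /c5_throughP[x2 [x3 [x4 [x5 c]]]].
  move/negP: (noC5 w x2 x3 x4 x5); apply; apply: c5_eq (c) => z zin.
  rewrite nbh_del_other //; apply: contraTneq zin => ->.
    by apply: contraNN nu; apply: (c5_mem c).
  by apply: contraNN nv; apply: (c5_mem c).
- rewrite eqxx ltnn /=; apply: proper_card; apply/properP; split.
    by apply/subsetP => p; rewrite !inE => /and3P[-> -> /andP[->]].
  by exists (u, v); rewrite !inE /= uA vA ?euv // /del_edge !eqxx andbF.
Qed.

Notation branch := (branch A e no_token).
Notation inner := (inner A e no_token).

Lemma nbh_pair_at w y : w \in A -> ~~ branch w -> y \in nb w ->
  exists a, [/\ a != y, nb w = [set y; a] & a \in A].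
Proof.
move=> wA nbw yw; have [||p [q [pq nw pA qA]]] := nbh_pair _ _ wA nbw => //.
  by move=> v /deg_ge2; rewrite /tdeg addn0.
move: yw; rewrite nw => /set2P[]->; [exists q | exists p] => //.
  by rewrite eq_sym pq.
by rewrite setUC.
Qed.

Lemma loop_not_root a p y r b : nb p = [set y; a] -> nb y = [set p; r] ->
  nb r = [set y; b] -> uniq [:: a; p; y; r; b] -> ~ c5_root A e no_token a b.
Proof.
move=> np ny nr us [x1 [y1 [z1 [s1 [[us1 aA _] [na nx ny1 nz ns]]]]]].
have pA : p \in A by have /nbhP[] : p \in nb y by rewrite ny !inE eqxx.
have /nbhP[_ epa] : a \in nb p by rewrite np !inE eqxx orbT.
have : p \in nb a by rewrite in_nbh pA e_sym.
rewrite na; move: us us1; rewrite /= !inE !negb_or !andbT.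
case/and4P=> /and4P[ap ay ar ab] /and3P[py pr pb] /andP[yr yb] rb.
case/and5P=> /and5P[ax1 ay1 az1 as1 _] /and4P[xy xz xs xb] /and3P[yz ys yb1] /andP[zs zb] sb.
have step w w1 w2 w3 w4 : nb w = [set w1; w2] -> nb w = [set w3; w4] -> w1 != w3 -> w1 = w4.
  move=> h1 h2 ne; have : w1 \in nb w by rewrite h1 !inE eqxx.
  by rewrite h2 => /set2P[] // h; rewrite h eqxx in ne.
have ny' : nb y = [set r; p] by rewrite ny setUC.
have nr' : nb r = [set b; y] by rewrite nr setUC.
case/orP=> [/orP[]|] /eqP pE; last by rewrite pE eqxx in pb.
- subst x1; have yE : y = y1 by apply: (step p y a a y1) => //; rewrite eq_sym.
  subst y1; have rE : r = z1 by apply: (step y r p p z1) => //; rewrite eq_sym.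
  subst z1; have bE : b = s1 by apply: (step r b y y s1) => //; rewrite eq_sym.
  by rewrite bE eqxx in sb.
- subst s1; have yE : y = z1.
    by apply: (step p y a a z1); rewrite 1?eq_sym // ns setUC.
  subst z1; have rE : r = y1.
    by apply: (step y r p p y1); rewrite 1?eq_sym // nz setUC.
  subst y1; have bE : b = x1.
    by apply: (step r b y y x1); rewrite 1?eq_sym // ny1 setUC.
  by rewrite -bE eqxx in xb.
Qed.

(** On this [C_5] the vertex [a] is the only branch vertex, so [r] is inner as well, and [b] is the
    second tail at the hub [a]. *)
Lemma loop_hub a p y r b : nb p = [set y; a] -> nb y = [set p; r] ->
  nb r = [set y; b] -> p != b -> e a b -> inner y ->
  branch a -> ~~ branch b -> ~~ branch r -> inner_hub A e no_token y.
Proof.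
move=> np ny nr pb eab iny ba nbb nbr.
have nby : ~~ branch y by case/and3P: iny.
have /nbhP[pA eyp] : p \in nb y by rewrite ny !inE eqxx.
have /nbhP[rA eyr] : r \in nb y by rewrite ny !inE eqxx orbT.
have /nbhP[_ epa] : a \in nb p by rewrite np !inE eqxx orbT.
have /nbhP[bA erb] : b \in nb r by rewrite nr !inE eqxx orbT.
exists a; split=> //.
  exists p, b, r; split=> //; split=> //; first by rewrite e_sym.
  apply/and3P; split=> //; apply/forall_inP => v.
  by rewrite nr => /set2P[]->.
move=> x1 v1 x1A eyx1 exv1 bv1.
have v1N : v1 \in nb x1 by rewrite in_nbh exv1 (branchA bv1).
have : x1 \in nb y by rewrite in_nbh x1A.
rewrite ny => /set2P[] x1E; move: v1N; rewrite x1E ?np ?nr => /set2P[] // v1E;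
  by move: bv1; rewrite v1E ?(negPf nby) ?(negPf nbb).
Qed.

(** Since [a] and [b] are not adjacent, the new edge preserves their degrees. The bypass can fail
    only by creating a [C_5] component; this uses the new edge, so the original component is a
    [C_8]. *)
Lemma shorten_thread a p y r b : uniq [:: a; p; y; r; b] ->
  a \in A -> b \in A -> nb p = [set y; a] -> nb y = [set p; r] ->
  nb r = [set y; b] -> ~~ e a b -> sol.
Proof.
move=> us aA bA np ny nr neab.
have /nbhP[pA eyp] : p \in nb y by rewrite ny !inE eqxx.
have /nbhP[rA eyr] : r \in nb y by rewrite ny !inE eqxx orbT.
have /nbhP[_ epa] : a \in nb p by rewrite np !inE eqxx orbT.
have /nbhP[yA epy] : y \in nb p by rewrite np !inE eqxx.
have /nbhP[_ erb] : b \in nb r by rewrite nr !inE eqxx orbT.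
set K := [set w in [:: p; y; r]]; pose e' := add_edge a b e.
have inK w : (w \in K) = (w \in [:: p; y; r]) by rewrite inE.
have [aK bK ab] : [/\ a \notin [:: p; y; r], b \notin [:: p; y; r] & a != b].
  have /and5P[] := us; rewrite !inE !negb_or.
  case/and4P=> ap ay ar ab /and3P[py pr pb] /andP[yr yb] rb _.
  by rewrite ap ay ar ab (eq_sym b) pb (eq_sym b) yb (eq_sym b) rb.
have old w x : w \in A -> w \notin [:: p; y; r] -> x \in nb w ->
    (x \in [:: p; y; r]) && ((w == a) && (x == p) || (w == b) && (x == r)) ||
    (x \in A :\: K).
  move=> wA wK xw; have [xA ewx] := nbhP xw.
  rewrite in_setD inK xA andbT; have [xK|//] := boolP (x \in [:: p; y; r]).
  have wx : w \in nb x by rewrite in_nbh wA e_sym.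
  move: wK; rewrite !inE !negb_or => /and3P[/negPf wp /negPf wy /negPf wr].
  move: xK; rewrite !inE => /or3P[]/eqP xE; move: wx; rewrite xE ?np ?ny ?nr;
    rewrite !inE ?wp ?wy ?wr //= => ->; by rewrite eqxx ?orbT.
have nbh'E w : w \in A -> w \notin [:: p; y; r] -> w != a -> w != b ->
    nbh (A :\: K) e' w = nb w.
  move=> wA wK wa wb; apply/setP => x; rewrite in_nbh /e' /add_edge (negPf wa) (negPf wb).
  rewrite /= orbF; apply/idP/idP => [/andP[/setDP[xA _] ewx]|xw].
    by rewrite in_nbh xA.
  have := old w x wA wK xw; rewrite (negPf wa) (negPf wb) /= andbF /= => ->.
  by case/nbhP: xw.
have end_nbh c d q : (c, d, q) = (a, b, p) \/ (c, d, q) = (b, a, r) ->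
    nbh (A :\: K) e' c = d |: (nb c :\ q) /\ d \notin nb c /\ q \in nb c.
  move=> h; have [cA dA cK dK [cd qA qK ecq necd]] : [/\ c \in A, d \in A,
      c \notin [:: p; y; r], d \notin [:: p; y; r] &
      [/\ c != d, q \in A, q \in [:: p; y; r], e c q & ~~ e c d]].
    case: h => [[-> -> ->]|[-> -> ->]].
      by split=> //; split=> //; [rewrite mem_head | rewrite e_sym].
    by split=> //; split=> //; [rewrite eq_sym | rewrite !inE eqxx !orbT
      | rewrite e_sym | rewrite e_sym].
  split; last by rewrite !in_nbh (negPf necd) andbF qA ecq.
  apply/setP => x; rewrite in_setU1 in_setD1 in_nbh.
  have -> : e' c x = e c x || (x == d).
    rewrite /e' /add_edge; case: h => [[-> -> _]|[-> -> _]]; rewrite eqxx.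
      by rewrite (negPf ab) /= orbF.
    by rewrite eq_sym (negPf ab).
  have [->|xd] /= := eqVneq x d; first by rewrite in_setD inK dK dA orbT.
  rewrite orbF; apply/idP/idP.
    case/andP=> /setDP[xA]; rewrite inK => xK ecx; rewrite in_nbh xA ecx !andbT.
    by apply: contraNneq xK => ->.
  case/andP=> xq xc; have [_ ->] := nbhP xc; rewrite andbT.
  have := old c x cA cK xc; case/orP=> // /andP[_].
  by case: h => [[cE _ qE]|[cE _ qE]]; rewrite -?cE -?qE ?eqxx (negPf xq) /= ?(negPf ab)
    ?andbF ?orbF //; rewrite cE ?(negPf ab) // eq_sym (negPf ab).
have [ea [ena pa]] := end_nbh a b p (or_introl erefl).
have [eb [enb rb]] := end_nbh b a r (or_intror erefl).
have e'_sym : symmetric e'.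
  by move=> x z; rewrite /e' /add_edge e_sym; congr (_ || _); rewrite orbC;
    congr (_ || _); apply: andbC.
have eap : e a p by rewrite e_sym.
have [thr|nthr] := boolP (c5_through (A :\: K) e' a).
  (* The [C_8] gets an explicit labelling of weight 4 + 6: 30 units out of 32. *)
  have oct x2 x3 x4 x5 : c5_at (A :\: K) e' a x2 x3 x4 x5 -> b = x2 -> sol.
    move=> c bE; subst x2; have [inA' /and5P[_ f2 f3 f4 f5]] := c5_edges c.
    have /andP[us5 _] := c.
    have us8 : uniq ([:: p; y; r] ++ [:: a; b; x3; x4; x5]).
      rewrite cat_uniq us5 andbT; apply/andP; split.
        exact: (mask_uniq us [:: false; true; true; true]).
      apply/hasPn => w /inA'; rewrite in_setD inK; by case/andP.
    pose s := [:: a; p; y; r; b; x3; x4; x5].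
    have sP : perm_eq s ([:: p; y; r] ++ [:: a; b; x3; x4; x5]).
      by rewrite perm_sym (perm_catCA [:: p; y; r] [:: a]).
    have uss : uniq s by rewrite (perm_uniq sP).
    have sE := perm_mem sP.
    have keep w w' : w \in [:: x3; x4; x5] -> e' w w' -> e w w'.
      move=> win; have wab : (w != a) && (w != b).
        move: us5; rewrite /= !inE !negb_or.
        case/and3P=> /and4P[_ a3 a4 a5] /and3P[b3 b4 b5] _.
        by move: win; rewrite !inE => /or3P[]/eqP->; rewrite ![_ == a]eq_sym
          ![_ == b]eq_sym ?a3 ?a4 ?a5 ?b3 ?b4 ?b5.
      by case/andP: wab => /negPf wa /negPf wb; rewrite /e' /add_edge wa wb orbF.
    pose E := [:: (0, 1); (1, 2); (2, 3); (3, 4); (4, 5); (5, 6); (6, 7); (7, 0)].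
    pose l : seq label :=
      [:: (true, false, 2); (false, false, 0); (false, true, 0); (false, false, 2);
          (true, false, 0); (false, false, 1); (false, true, 1); (false, false, 0)].
    apply: (@remove_component s l E a) => //.
    - move=> w; rewrite sE mem_cat => /orP[|/inA']; last by case/setDP.
      by rewrite !inE => /or3P[]/eqP->.
    - apply/allP => w; rewrite sE mem_cat => win; apply/subsetP => x xw.
      rewrite [x \in [set _ in _]]inE sE mem_cat.
      case/orP: win => win.
        move: win; rewrite !inE => /or3P[]/eqP wE; move: xw;
          rewrite wE ?np ?ny ?nr => /set2P[]->; by rewrite eqxx ?orbT.
      have [wA wK] : w \in A /\ w \notin [:: p; y; r].
        by have := inA' w win; rewrite in_setD inK => /andP[].
      have [//|xK] := boolP (x \in [:: p; y; r]); apply: (c5_closed c win).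
      have [xA ewx] := nbhP xw.
      by rewrite in_nbh in_setD inK xK xA /e' /add_edge ewx.
    - rewrite /= eap epy eyr erb (keep x3 x4) ?(keep x4 x5) ?(keep x5 a) ?inE ?eqxx ?orbT //.
      by rewrite e_sym (keep x3 b) ?inE ?eqxx // e'_sym.
  case/c5_throughP: thr => x2 [x3 [x4 [x5 c]]].
  have /and5P[_ /eqP n1 _ _ _] := c.
  have : b \in [set x5; x2] by rewrite -n1 ea !inE eqxx.
  by case/set2P=> bE; [apply: (oct _ _ _ _ (c5_rev c)) | apply: (oct _ _ _ _ c)].
apply: (@subdivide_solvable T A e a p y r b) => //.
  move=> w; rewrite !inE => /or4P[|||/orP[]] /eqP-> //.
apply: smaller; first exact: e'_sym.
- move=> x; rewrite /add_edge e_irr /= [(x == b) && _]andbC orbb.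
  by apply: contraNF ab => /andP[/eqP<- ].
- split=> [w|w].
    rewrite in_setD inK => /andP[wK wA].
    have [->|wa] := eqVneq w a.
      have := deg_ge2 aA; rewrite ea cardsU1 in_setD1 (negPf ena) andbF.
      by have := cardsD1 p (nb a); rewrite pa /=; clear; lia.
    have [->|wb] := eqVneq w b; last by rewrite nbh'E // deg_ge2.
    have := deg_ge2 bA; rewrite eb cardsU1 in_setD1 (negPf enb) andbF.
    by have := cardsD1 r (nb b); rewrite rb /=; clear; lia.
  apply/negP => /c5_throughP[x2 [x3 [x4 [x5 c]]]].
  move/negP: (noC5 w x2 x3 x4 x5); apply; apply: c5_eq (c) => z zin.
  have [inA' _] := c5_edges c.
  have za : z != a by apply: contraNneq nthr => zE; rewrite zE in zin; apply: (c5_mem c zin).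
  have zb : z != b.
    apply: contraNneq nthr => zE; rewrite zE in zin; apply: (c5_mem c).
    by apply: (c5_closed c zin); rewrite eb !inE eqxx.
  have := inA' z zin; rewrite in_setD inK => /andP[zK zA].
  by rewrite nbh'E.
- apply/orP; left; apply: proper_card; apply/properP; split; first exact: subsetDl.
  by exists y => //; rewrite !inE eqxx orbT.
Qed.

(** The neighbours [p] and [r] of [y] have degree 2 and lead on to [a] and [b]. If [a = r], the
    component is a triangle; if [a = b], there is a [C_4], with hub [a] or a component by itself;
    nonadjacent [a] and [b] allow the bypass. In the remaining [C_5] only [a] and [b] can be branch
    vertices: if both are, their edge can be deleted; if one is, it is the hub; if none is, the
    cycle is an excluded component. *)
Lemma inner_vertex y : inner y -> sol \/ inner_hub A e no_token y.
Proof.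
move=> iny; case/and3P: (iny) => yA nby /forall_inP nbN.
have [||p [r [pr ny pA rA]]] := nbh_pair _ _ yA nby => //.
  by move=> v /deg_ge2; rewrite /tdeg addn0.
have [/nbhP[_ eyp] nbp] : p \in nb y /\ ~~ branch p.
  have h : p \in nb y by rewrite ny !inE eqxx.
  by split=> //; apply: nbN.
have [/nbhP[_ eyr] nbr] : r \in nb y /\ ~~ branch r.
  have h : r \in nb y by rewrite ny !inE eqxx orbT.
  by split=> //; apply: nbN.
have [a [ay np aA]] : exists a, [/\ a != y, nb p = [set y; a] & a \in A].
  by apply: nbh_pair_at => //; rewrite in_nbh yA e_sym.
have [b [by_ nr bA]] : exists b, [/\ b != y, nb r = [set y; b] & b \in A].
  by apply: nbh_pair_at => //; rewrite in_nbh yA e_sym.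
have ne u v : e u v -> u != v by apply: contraTneq => ->; rewrite e_irr.
have /nbhP[_ epa] : a \in nb p by rewrite np !inE eqxx orbT.
have /nbhP[_ erb] : b \in nb r by rewrite nr !inE eqxx orbT.
have yp := ne _ _ eyp; have yr := ne _ _ eyr; have pa := ne _ _ epa; have rb := ne _ _ erb.
have subset2 (u v : T) (s : seq T) : u \in s -> v \in s -> [set u; v] \subset [set x in s].
  by move=> us vs; apply/subsetP => w /set2P[]->; rewrite inE.
have [ar|ar] := eqVneq a r.
  have bp : b = p.
    have : p \in nb r by rewrite in_nbh pA -ar e_sym.
    by rewrite nr => /set2P[pE|//]; rewrite pE eqxx in yp.
  left; apply: (@remove_component [:: p; y; r]
    [:: (false, false, 0); (true, true, 2); (false, false, 0)] [:: (0, 1); (1, 2)] p) => //.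
  - by rewrite /= !inE negb_or (eq_sym p) yp pr yr.
  - by move=> w; rewrite !inE => /or3P[]/eqP->.
  - by rewrite /= np ny nr ar bp !subset2 ?inE ?eqxx ?orbT.
  - by rewrite /= e_sym eyp eyr.
have [ab|ab] := eqVneq a b.
  subst b; have [ba|nba] := boolP (branch a).
    right; exists a; split=> //.
      by exists p, r, y; split=> //; split=> //; rewrite // e_sym.
    move=> x1 v1 x1A eyx1 exv1 bv1.
    have v1N : v1 \in nb x1 by rewrite in_nbh exv1 (branchA bv1).
    have : x1 \in nb y by rewrite in_nbh x1A.
    rewrite ny => /set2P[] x1E; move: v1N; rewrite x1E ?np ?nr => /set2P[] // v1E;
      by move: bv1; rewrite v1E (negPf nby).
  have [c [cp na cA]] : exists c, [/\ c != p, nb a = [set p; c] & c \in A].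
    by apply: nbh_pair_at => //; rewrite in_nbh pA e_sym.
  have rc : r = c.
    have : r \in nb a by rewrite in_nbh rA e_sym.
    by rewrite na => /set2P[rE|//]; rewrite rE eqxx in pr.
  subst c; left; apply: (@remove_component [:: y; p; a; r]
    [:: (true, false, 2); (false, false, 0); (false, true, 1); (false, false, 0)]
    [:: (0, 1); (1, 2); (2, 3); (3, 0)] p) => //.
  - by rewrite /= !inE !negb_or yp yr pa pr ar (eq_sym y) ay.
  - by move=> w; rewrite !inE => /or4P[]/eqP->.
  - by rewrite /= np ny nr na !subset2 ?inE ?eqxx ?orbT.
  - by rewrite /= eyp epa (e_sym a) erb (e_sym r) eyr.
have bp : b != p.
  apply: contraNneq ar => bp; have : r \in nb p by rewrite in_nbh rA e_sym -bp.
  by rewrite np => /set2P[rE|->//]; rewrite rE eqxx in yr.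
have us : uniq [:: a; p; y; r; b].
  by rewrite /= !inE !negb_or (eq_sym a) pa ay ar ab (eq_sym p) yp pr (eq_sym p) bp yr
    (eq_sym y) by_ rb.
have us' : uniq [:: b; r; y; p; a] by rewrite -rev_uniq.
have ny' : nb y = [set r; p] by rewrite setUC.
have [eab|neab] := boolP (e a b); last first.
  by left; apply: (shorten_thread us).
have [ba|nba] := boolP (branch a); have [bb|nbb] := boolP (branch b).
- case: (adjacent_branches ba bb eab) => [|[h|h]]; first by left.
    by case: (loop_not_root np ny nr us h).
  by case: (loop_not_root nr ny' np us' h).
- by right; apply: (loop_hub np ny nr _ eab) => //; rewrite eq_sym.
- by right; apply: (loop_hub nr ny' np) => //; rewrite 1?eq_sym // e_sym.
have [c [cp na _]] : exists c, [/\ c != p, nb a = [set p; c] & c \in A].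
  by apply: nbh_pair_at => //; rewrite in_nbh pA e_sym.
have bc : b = c.
  have : b \in nb a by rewrite in_nbh bA eab.
  by rewrite na => /set2P[bE|//]; rewrite bE eqxx in bp.
have [d [dr nb_ _]] : exists d, [/\ d != r, nb b = [set r; d] & d \in A].
  by apply: nbh_pair_at => //; rewrite in_nbh rA e_sym.
have ad : a = d.
  have : a \in nb b by rewrite in_nbh aA e_sym.
  by rewrite nb_ => /set2P[aE|//]; rewrite aE eqxx in ar.
subst c d; case/negP: (noC5 y p a b r); apply/and5P; split.
- by rewrite -rev_uniq -(rot_uniq 2).
- by rewrite ny setUC.
- by rewrite np.
- by rewrite na.
- by rewrite nb_ nr setUC eqxx (setUC [set b]) eqxx.
Qed.

Lemma minimal_solvable : sol.
Proof.
have [|adj] : sol \/ forall u v, branch u -> branch v -> e u v ->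
    c5_root A e no_token u v \/ c5_root A e no_token v u.
  apply: finite_alternative => u; apply: finite_alternative => v.
  have [/and3P[bu bv euv]|h] := boolP [&& branch u, branch v & e u v].
    by case: (adjacent_branches bu bv euv) => [|h]; [left | right].
  by right=> bu bv euv; rewrite bu bv euv in h.
  by [].
have [|hub] : sol \/ forall y, inner y -> inner_hub A e no_token y.
  apply: finite_alternative => y; have [iy|niy] := boolP (inner y).
    by case: (inner_vertex iy) => [|h]; [left | right].
  by right.
  by [].
apply: reduced_solvable => //; split=> //.
by move=> v vA; rewrite /tdeg addn0 deg_ge2.
Qed.

End Minimal.

Lemma good_solvable (T : finType) (A : {set T}) (e : rel T) :
  symmetric e -> irreflexive e -> good_graph A e -> solvable A e no_token.
Proof.
have [n] := ubnP #|A|; elim: n A e => // n IHn A e ltAn.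
have [m] := ubnP #|arcs A e|; elim: m e => // m IHm e ltem e_sym e_irr goodA.
apply: minimal_solvable => // A' e' e'_sym e'_irr good' /orP[ltA|].
  by apply: IHn => //; apply: leq_trans ltA _.
case/andP=> /eqP AE lte; rewrite AE in good' lte *.
by apply: IHm => //; apply: leq_trans lte _.
Qed.

(** * From labellings to the two domination numbers *)

Section Bridge.

Variables (T : finType) (e : rel T).

Lemma nbh_setT v : nbh [set: T] e v = neighborhood e v.
Proof. by apply/setP => w; rewrite !inE. Qed.

(** The five vertices are closed under adjacency, so connectedness leaves no others. *)
Lemma c5_iso x1 x2 x3 x4 x5 : symmetric e -> (forall u v, connect e u v) ->
  c5_at [set: T] e x1 x2 x3 x4 x5 -> graph_isomorphic e (@cycle_graph 5).
Proof.
move=> e_sym conn c; pose s := [:: x1; x2; x3; x4; x5].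
have all_s w : w \in s.
  have cl : closed e (mem s).
    apply: intro_closed; first exact: sym_connect_sym.
    by move=> x y exy xs; apply: (c5_closed c xs); rewrite in_nbh inE.
  by rewrite -(closed_connect cl (conn x1 w)) mem_head.
have /and5P[us /eqP n1 /eqP n2 /eqP n3 /andP[/eqP n4 /eqP n5]] := c.
pose g (i : 'I_5) := nth x1 s i.
have lts w : index w s < 5 by rewrite -[5]/(size s) index_mem.
pose h w := Ordinal (lts w).
have hK : cancel h g by move=> w; rewrite /g nth_index.
have gK : cancel g h by move=> i; apply: val_inj; exact: (@index_uniq T x1 i s (ltn_ord i) us).
have ge i j : cycle_graph i j = e (g i) (g j).
  have -> : e (g i) (g j) = (g j \in nbh [set: T] e (g i)) by rewrite in_nbh inE.
  have -> : nbh [set: T] e (g i) = [set nth x1 s ((i + 4) %% 5); nth x1 s (i.+1 %% 5)].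
    by case: i => [[|[|[|[|[|]]]]] //] lti; rewrite /g /= ?n1 ?n2 ?n3 ?n4 ?n5.
  rewrite !inE /g !nth_uniq ?ltn_mod //.
  by case: i => [[|[|[|[|[|]]]]] //] lti; case: j => [[|[|[|[|[|]]]]] //] ltj.
exists h; first by exists g.
by move=> x y; rewrite ge !hK.
Qed.

Lemma solvable_gamma : solvable [set: T] e no_token ->
  3 * (gamma_r2 e + gamma_R e) <= 4 * #|T|.
Proof.
case=> L domL costL.
pose f := [ffun u => [set i : 'I_2 | if i == ord0 then has1 (L u) else has2 (L u)]].
(* Labels put no bound on Roman values. Truncating at 2 keeps positive values positive and each 2 a
   2, and never raises the weight. *)
pose g := [ffun u => inord (minn (roman (L u)) 2) : 'I_3].
have gE u : g u = minn (roman (L u)) 2 :> nat.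
  by rewrite ffunE inordK // ltnS geq_minr.
have fdom : rainbow2_dominating e f.
  apply/forallP => u; apply/implyP => /eqP fu.
  have [rb _] := domL u (in_setT u).
  have : (ord0 \in f u) = false /\ (ord_max \in f u) = false by rewrite fu !inE.
  rewrite /f ffunE !inE /= => -[h1 h2].
  move: rb; rewrite /rainbow_at h1 h2 /= !nbh_setT.
  case/andP=> /exists_inP[v vu v1] /exists_inP[w wu w2].
  rewrite eqEsubset subsetT /=; apply/subsetP => i _; apply/bigcupP.
  have [i0|i0] := boolP (i == ord0).
    by exists v; rewrite // ffunE inE i0.
  by exists w; rewrite // ffunE inE (negPf i0).
have gdom : roman_dominating e g.
  apply/forallP => u; apply/implyP => /eqP gu.
  have [_] := domL u (in_setT u); rewrite /roman_at !nbh_setT /= => /orP[|].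
    by move: gu; rewrite gE; clear; lia.
  case/exists_inP=> v vu /eqP v2; apply/exists_inP; exists v => //.
  by rewrite gE v2.
have fcard u : #|f u| = has1 (L u) + has2 (L u).
  rewrite ffunE cardsE -sum1_card big_mkcond !big_ord_recl big_ord0 /=.
  by rewrite ?inE; case: (has1 _); case: (has2 _).
have := (gamma_r2P e).2 f fdom; have := (gamma_RP e).2 g gdom.
rewrite /rainbow2_weight /roman_weight.
have : \sum_u #|f u| + \sum_u g u <= \sum_u weight (L u).
  rewrite -big_split; apply: leq_sum => u _.
  by rewrite /= fcard gE /weight leq_add2l geq_minl.
move: costL; rewrite /affordable.
rewrite (eq_bigr (fun v => 3 * weight (L v))) => [|v _]; last by rewrite addn0.
rewrite [leqRHS](eq_bigr (fun=> 4)) => [|v _]; last by rewrite muln0 mul0n addn0.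
rewrite sum_nat_const cardsT -big_distrr /=.
rewrite (eq_bigl xpredT) => [|v]; last by rewrite inE.
rewrite mulnC => cost le_w le_R le_r2; apply: leq_trans _ (eq_leq (mulnC _ _)).
apply: leq_trans cost; rewrite mulnC leq_mul2r; apply: leq_trans le_w.
exact: leq_add.
Qed.

End Bridge.

Import Order.TTheory GRing.Theory Num.Theory.

Local Open Scope ring_scope.

Theorem theorem3 (T : finType) (e : rel T)
    (e_sym : symmetric e) (e_irr : irreflexive e)
    (e_conn : connected_graph e)
    (e_deg : min_degree_ge e 2)
    (e_nC5 : ~ graph_isomorphic e (@cycle_graph 5)) :
  (gamma_r2 e)%:R + (gamma_R e)%:R <= 4%:R / 3%:R * #|T|%:R :> rat.
Proof.
have : (3 * (gamma_r2 e + gamma_R e) <= 4 * #|T|)%N.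
  apply: solvable_gamma; apply: good_solvable => //; split=> [v _|v].
    by rewrite nbh_setT; apply: e_deg.
  apply/negP => /c5_throughP[x2 [x3 [x4 [x5 c]]]]; apply: e_nC5.
  by apply: c5_iso c => //; case: e_conn.
rewrite -(ler_nat rat) !natrM natrD; lra.
Qed.
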